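(* (a) Let $p>2$ be a real number. Then there exists $n_0=n_0(p)$ such that, for all $n\ge n_0$, we have $\mathrm{ex}_p(n,C_4)=e_p(L(n,1,1))$, and $L(n,1,1)$ is the unique extremal graph. (b) Let $k\ge 3$ be an integer and $p>\frac{k}{k-1}$ a real number. Then there exists $n_0=n_0(k,p)$ such that, for all $n\ge n_0$, we have $\mathrm{ex}_p(n,C_{2k})=e_p(E(n,k-1))$, and $E(n,k-1)$ is the unique extremal graph.
   Context: All graphs are finite, simple and undirected; uniqueness is up to isomorphism. $C_m$ is the cycle on $m$ vertices. A graph is $F$-free if it does not contain $F$ as a (not necessarily induced) subgraph. For real $p>0$, $e_p(G)=\sum_{v\in V(G)}d_G(v)^p$, and $\mathrm{ex}_p(n,F)$ is the maximum of $e_p(G)$ over all $F$-free graphs $G$ on $n$ vertices; an extremal graph is an $F$-free graph on $n$ vertices attaining this maximum. The join $G\vee H$ is obtained from vertex-disjoint copies of $G$ and $H$ by adding all edges between them. $L(n,s,1)=K_s\vee L$, where $L$ is the graph on $n-s$ vertices that is a perfect matching if $n-s$ is even, and consists of a matching covering all but one vertex together with one isolated vertex if $n-s$ is odd. $E(n,s)=K_s\vee E^+_{n-s}$, where $E^+_t$ is the graph on $t$ vertices with exactly one edge. *)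

(* Defs.v *)
From HB Require Import structures.
From mathcomp Require Import all_boot all_order all_algebra.
From mathcomp Require Import all_classical all_reals all_analysis.

Set Implicit Arguments.
Unset Strict Implicit.
Unset Printing Implicit Defensive.

Import Order.TTheory GRing.Theory Num.Theory.
Local Open Scope ring_scope.

Record sgraph := SGraph {
  vertex :> finType;
  edge : rel vertex;
  edge_sym : symmetric edge;
  edge_irrefl : irreflexive edge }.

Definition deg (G : sgraph) (v : G) : nat := #|[set w : G | edge v w]|.

(* Not necessarily induced: non-edges of F may be mapped to edges of G. *)
Definition subgraph (F G : sgraph) : Prop :=
  exists2 f : F -> G, injective f & forall x y, edge x y -> edge (f x) (f y).

Definition free (F G : sgraph) : Prop := ~ subgraph F G.

Definition isomorphic (G H : sgraph) : Prop :=
  exists2 f : G -> H, bijective f & forall x y, edge (f x) (f y) = edge x y.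

Section Constructions.

Variable n : nat.

Let complete_rel : rel 'I_n := fun i j => i != j.

Let complete_sym : symmetric complete_rel.
Proof. by move=> i j; rewrite /complete_rel eq_sym. Qed.

Let complete_irrefl : irreflexive complete_rel.
Proof. by move=> i; rewrite /complete_rel eqxx. Qed.

Definition complete : sgraph := SGraph complete_sym complete_irrefl.

(* [ordS] is the successor modulo n; the graph is an actual cycle when
   3 <= n, the clause [i != j] only matters for n = 1. *)
Let cycle_rel : rel 'I_n :=
  fun i j => (i != j) && ((ordS i == j) || (ordS j == i)).

Let cycle_sym : symmetric cycle_rel.
Proof. by move=> i j; rewrite /cycle_rel eq_sym orbC. Qed.

Let cycle_irrefl : irreflexive cycle_rel.
Proof. by move=> i; rewrite /cycle_rel eqxx. Qed.

Definition cycle_graph : sgraph := SGraph cycle_sym cycle_irrefl.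

(* The edges are {0,1}, {2,3}, {4,5}, ...; the last vertex is isolated when
   n is odd. *)
Let matching_rel : rel 'I_n := fun i j => (i != j) && (i./2 == j./2).

Let matching_sym : symmetric matching_rel.
Proof. by move=> i j; rewrite /matching_rel eq_sym [_./2 == _]eq_sym. Qed.

Let matching_irrefl : irreflexive matching_rel.
Proof. by move=> i; rewrite /matching_rel eqxx. Qed.

Definition matching : sgraph := SGraph matching_sym matching_irrefl.

(* The only edge is {0,1} (for 2 <= n). *)
Let one_edge_rel : rel 'I_n := fun i j => [&& i != j, (i < 2)%N & (j < 2)%N].

Let one_edge_sym : symmetric one_edge_rel.
Proof. by move=> i j; rewrite /one_edge_rel eq_sym [(i < 2)%N && _]andbC. Qed.

Let one_edge_irrefl : irreflexive one_edge_rel.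
Proof. by move=> i; rewrite /one_edge_rel eqxx. Qed.

Definition one_edge : sgraph := SGraph one_edge_sym one_edge_irrefl.

End Constructions.

Section Join.

Variables G H : sgraph.

Let join_rel : rel (G + H)%type := fun x y =>
  match x, y with
  | inl a, inl b => edge a b
  | inr a, inr b => edge a b
  | _, _ => true
  end.

Let join_sym : symmetric join_rel.
Proof. by move=> [a|a] [b|b] //=; exact: edge_sym. Qed.

Let join_irrefl : irreflexive join_rel.
Proof. by move=> [a|a] /=; exact: edge_irrefl. Qed.

Definition join : sgraph := SGraph join_sym join_irrefl.

End Join.

(* L(n, s, 1); it has n vertices when s <= n. *)
Definition Lgraph1 (n s : nat) : sgraph := join (complete s) (matching (n - s)).

(* E(n, s); it has n vertices when s <= n. *)
Definition Egraph (n s : nat) : sgraph := join (complete s) (one_edge (n - s)).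

Section DegreePowers.

Variables (R : realType) (p : R).

Definition e_p (G : sgraph) : R := \sum_(v : G) (deg v)%:R `^ p.

(* There are finitely many graphs on n vertices up to isomorphism, so this
   supremum is a maximum as soon as some n-vertex graph is F-free. *)
Definition ex_p (n : nat) (F : sgraph) : R :=
  sup [set x : R | exists G : sgraph,
    [/\ #|{: G}| = n, free F G & x = e_p G] ]%classic.

Definition extremal (n : nat) (F G : sgraph) : Prop :=
  [/\ #|{: G}| = n, free F G & e_p G = ex_p n F].

Definition unique_extremal (n : nat) (F G : sgraph) : Prop :=
  extremal n F G /\ forall H : sgraph, extremal n F H -> isomorphic H G.

End DegreePowers.

(* Main.v *)
(** Put q = k / (k - 1).

    Tail bound: in a C_2k-free graph on n vertices, the number t of vertices of degree at
    least D satisfies t^(k-1) D^k <= C n^k. Indeed, pass to a bipartite subgraph between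
    these vertices and the others whose minimum degrees are of order D and t D / n on the
    two sides, and explore it by breadth-first search. Two consecutive layers span only
    linearly many edges: otherwise descend the search tree to a vertex y below which the
    edges are spread over several children of y; a zigzag path between the two layers
    that joins descendants of different children then closes through y to a 2k-cycle.
    Hence the layers grow geometrically, and the k-th layer fits in its side.

    Summing dyadically, e_p(G) <= C n^p for p > q, and vertices of degree at most delta n
    contribute only eps n^p. The boundedly many remaining vertices have degree sum at most
    (k - 1 + o(1)) n, as k of them have fewer than k common neighbours. So if
    e_p(G) >= (k - 1) (n - 1)^p, there is a set S of k - 1 vertices of degree at least
    (1 - eta) n. Let B be the set of vertices outside S that are not adjacent to all of S.
    Each vertex of B costs S about n^(p-1), whereas B gains at most
    O(|B|) + O(|B|^p) << |B| n^(p-1), by the bound on e_p for the graph induced on B.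
    Thus B is empty, and excluding 2k-cycles leaves room outside S for a single edge
    (k >= 3) or a matching (k = 2). *)

Require Import Defs.
From mathcomp Require Import all_boot all_order all_algebra.
From mathcomp Require Import zify ring lra.

Set Implicit Arguments.
Unset Strict Implicit.
Unset Printing Implicit Defensive.

Import Order.TTheory GRing.Theory Num.Theory.

(** * Dense consecutive layers of a tree contain a long cycle *)

Lemma exists_notin_seq (T : finType) (X : {set T}) (s : seq T) :
  size s < #|X| -> exists2 x, x \in X & x \notin s.
Proof.
move=> sX; have /subsetPn[x xX xs] : ~~ (X \subset s).
  by apply: contraL sX => /subset_leq_card Xs; rewrite -leqNgt (leq_trans Xs) ?card_size.
by exists x.
Qed.

Section Layered.
Variables (T : finType) (h : rel T).
Hypothesis h_sym : symmetric h.

Definition nbrs_in (L : {set T}) (z : T) : {set T} := [set a in L | h z a].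

Section Labelled.
Variables (I : finType) (chi : T -> I).

Definition nbrs_class (L : {set T}) (z : T) (c : I) : {set T} :=
  [set a in nbrs_in L z | chi a == c].

Definition max_class (L : {set T}) (z : T) : nat :=
  \max_(c : I) #|nbrs_class L z c|.

(** This counts the neighbours outside the most frequent class. Whatever single class is forbidden,
    at least this many neighbours avoid it, which a large degree alone does not ensure. *)
Definition spread (L : {set T}) (z : T) : nat :=
  #|nbrs_in L z| - max_class L z.

Lemma max_class_le L z : max_class L z <= #|nbrs_in L z|.
Proof.
by apply/bigmax_leqP => c _; apply: subset_leq_card; apply/subsetP => a; rewrite inE => /andP[].
Qed.

Lemma spread_le_notin L z c :
  spread L z <= #|[set a in nbrs_in L z | chi a != c]|.
Proof.
have hN : #|nbrs_in L z| = #|nbrs_class L z c| + #|[set a in nbrs_in L z | chi a != c]|.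
  rewrite -(cardsID [set a | chi a == c] (nbrs_in L z)); congr (_ + _).
    by congr #|pred_of_set _|; apply/setP => a; rewrite !inE.
  by congr #|pred_of_set _|; apply/setP => a; rewrite !inE andbC.
have hM : #|nbrs_class L z c| <= max_class L z.
  exact: (leq_bigmax (F := fun c => #|nbrs_class L z c|)).
by rewrite /spread hN leq_subLR leq_add2r.
Qed.

Lemma spread_remove (L : {set T}) (z a : T) :
  a \in L -> spread L z <= spread (L :\ a) z + h z a.
Proof.
move=> aL.
have hN : #|nbrs_in L z| = h z a + #|nbrs_in (L :\ a) z|.
  rewrite (cardsD1 a (nbrs_in L z)) inE aL /=; congr (_ + _).
  by congr #|pred_of_set _|; apply/setP => b; rewrite !inE andbA.
have hM : max_class (L :\ a) z <= max_class L z.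
  apply/bigmax_leqP => c _.
  apply: leq_trans (leq_bigmax (F := fun c => #|nbrs_class L z c|) c).
  apply: subset_leq_card; apply/subsetP => b; rewrite !inE.
  by move=> /andP[/andP[/andP[_ ->] ->] ->].
rewrite /spread hN; move: hM; move: (h z a : nat) => x; lia.
Qed.

(** Delete violating vertices one at a time. Deleting from [Z] removes at most [t] from the sum;
    deleting [a] from [L] lowers each spread by at most [h z a], hence the sum by at most [t]. The
    strict inequality survives, so [Z] cannot be exhausted. *)
Lemma prune_spread (t : nat) (L Z : {set T}) :
  t * (#|L| + #|Z|) < \sum_(z in Z) spread L z ->
  exists L' Z' : {set T}, [/\ L' \subset L, Z' \subset Z, Z' != set0,
    {in Z', forall z, t < spread L' z} &
    {in L', forall a, t < #|nbrs_in Z' a|}].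
Proof.
move: {2}(_ + _) (leqnn (#|L| + #|Z|)) => m.
elim: m => [|m IHm] in L Z *.
  rewrite leqn0 addn_eq0 !cards_eq0 => /andP[_ /eqP ->].
  by rewrite big_set0 ltn0.
move=> szm big.
have [z /andP[zZ zt]|noz] := pickP [pred z in Z | spread L z <= t].
  have Zz : #|Z| = #|Z :\ z|.+1 by rewrite (cardsD1 z) zZ.
  have [||L' [Z' [LL ZZ H1 H2 H3]]] := IHm L (Z :\ z).
  - by move: szm; rewrite Zz; lia.
  - move: big; rewrite (big_setD1 z) //= Zz; nia.
  - by exists L', Z'; split=> //; apply: (subset_trans ZZ); exact: subD1set.
have [a /andP[aL at_]|noa] := pickP [pred a in L | #|nbrs_in Z a| <= t].
  have La : #|L| = #|L :\ a|.+1 by rewrite (cardsD1 a) aL.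
  have [||L' [Z' [LL ZZ H1 H2 H3]]] := IHm (L :\ a) Z.
  - by move: szm; rewrite La; lia.
  - have : \sum_(z in Z) spread L z <= \sum_(z in Z) (spread (L :\ a) z + h z a).
      by apply: leq_sum => z _; exact: spread_remove.
    rewrite big_split /=.
    have -> : \sum_(z in Z) h z a = #|nbrs_in Z a|.
      rewrite -sum1_card /= [RHS](eq_bigl (fun z => (z \in Z) && h z a)); last first.
        by move=> z; rewrite inE h_sym.
      by rewrite [RHS]big_mkcondr; apply: eq_bigr => z _; case: (h z a).
    by move: big; rewrite La; nia.
  - by exists L', Z'; split=> //; apply: (subset_trans LL); exact: subD1set.
exists L, Z; split=> //.
- by apply: contraTneq big => ->; rewrite big_set0 ltn0.
- by move=> z zZ; have := noz z; rewrite /= zZ /= leqNgt => /negbFE.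
- by move=> a aL; have := noa a; rewrite /= aL /= leqNgt => /negbFE.
Qed.

(** Greedy extension by two vertices at a time: at most [t] vertices are already used, so there is a
    fresh neighbour in [Z], and then a fresh one in [L] whose class differs from that of [a]. *)
Lemma zigzag_path (t l : nat) (L Z : {set T}) (a : T) :
  [disjoint L & Z] -> a \in L -> 2 * l <= t ->
  {in Z, forall z, t < spread L z} -> {in L, forall a, t < #|nbrs_in Z a|} ->
  exists p, [/\ path h a p, size p = 2 * l, uniq (a :: p),
    {subset p <= L :|: Z} & last a p \in L /\ (0 < l -> chi (last a p) != chi a)].
Proof.
move=> dLZ aL lt hZ hL; elim: l lt => [|l IHl] lt.
  by exists [::]; split.
have [|p [pp szp up subp [lastL _]]] := IHl; first by lia.
have [|z] := @exists_notin_seq _ (nbrs_in Z (last a p)) (a :: p).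
  by rewrite /= szp; apply: leq_trans (hL _ lastL); lia.
rewrite inE => /andP[zZ hz zp].
have [|b] := @exists_notin_seq _ [set b in nbrs_in L z | chi b != chi a] (a :: rcons p z).
  by rewrite /= size_rcons szp; apply: leq_trans (leq_trans (hZ _ zZ) (spread_le_notin _ _ _)); move: lt; rewrite mulnS ltnS.
rewrite !inE => /andP[/andP[bL hb] chib bp].
exists (rcons (rcons p z) b); split.
- by rewrite !rcons_path pp hz last_rcons hb.
- by rewrite !size_rcons szp mulnS.
- move: zp bp up; rewrite /= !rcons_uniq !(inE, mem_rcons) !negb_or.
  move=> /andP[za zp] /and3P[ba bz bp] /andP[ap ->].
  by rewrite [a == z]eq_sym [a == b]eq_sym za zp ba bz bp ap.
- move=> x; rewrite !(mem_rcons, inE).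
  by case/or3P => [/eqP->|/eqP->|/subp]; rewrite ?bL ?zZ ?orbT // inE.
- by rewrite last_rcons.
Qed.

End Labelled.

Section Tree.
Variables (lvl : T -> nat) (par : T -> T) (i : nat).
Hypothesis par_edge : forall x, 0 < lvl x <= i -> h x (par x).
Hypothesis par_lvl : forall x, 0 < lvl x <= i -> (lvl (par x)).+1 = lvl x.

Lemma lvl_iter_par x s : s <= lvl x <= i -> lvl (iter s par x) + s = lvl x.
Proof.
move=> /andP[sx xi]; elim: s sx => [|s IHs] sx; first by rewrite addn0.
have {}IHs := IHs (ltnW sx).
by rewrite iterS addnS -addSn par_lvl //; apply/andP; split; lia.
Qed.

Lemma climb_path x m : m <= lvl x <= i -> path h x (traject par (par x) m).
Proof.
elim: m x => [//|m IHm] x /andP[mx xi] /=.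
have hx : 0 < lvl x <= i by rewrite xi andbT (leq_trans _ mx).
rewrite par_edge //= IHm //.
by have := par_lvl hx; lia.
Qed.

Lemma climb_mem x m y : m <= lvl x <= i -> y \in traject par (par x) m ->
  exists s, [/\ 0 < s <= m, y = iter s par x & lvl y + s = lvl x].
Proof.
move=> /andP[mx xi] /trajectP[s sm ->]; exists s.+1.
have E : iter s par (par x) = iter s.+1 par x by rewrite iterSr.
by rewrite E; split=> //; apply: lvl_iter_par; lia.
Qed.

Lemma climb_uniq x m : m <= lvl x <= i -> uniq (traject par (par x) m).
Proof.
elim: m x => [//|m IHm] x /andP[mx xi] /=.
have hx : 0 < lvl x <= i by rewrite xi andbT (leq_trans _ mx).
have hp := par_lvl hx.
rewrite IHm; last by lia.
rewrite andbT; apply/negP => /climb_mem[|s [s0 _ hs]]; first by lia.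
by lia.
Qed.

(** The climbs from [a] and [b] first meet [j.+1] generations up. The cycle runs along [p], climbs
    from [b] to the common ancestor and descends to [a]; the climbs stay strictly below level [i],
    hence off [p]. *)
Lemma close_cycle (a b : T) (p : seq T) (j : nat) :
  j < i -> path h a p -> last a p = b -> uniq (a :: p) ->
  {in p, forall x, i <= lvl x} -> lvl a = i -> lvl b = i ->
  iter j par a != iter j par b -> iter j.+1 par a = iter j.+1 par b ->
  exists c, [/\ uniq c, cycle h c & size c = size p + (2 * j).+2].
Proof.
move=> ji pp lastp up lvlp lvla lvlb neq_ab eq_ab.
have ha : j <= lvl a <= i by lia.
have hb : j.+1 <= lvl b <= i by lia.
exists ((a :: p) ++ traject par (par b) j.+1 ++ rev (traject par (par a) j)).
split.
- have ub := climb_uniq hb; have mb := fun x => @climb_mem b j.+1 x hb.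
  set tb := traject par (par b) j.+1 in ub mb *.
  rewrite cat_uniq up cat_uniq rev_uniq climb_uniq // ub andbT andTb.
  apply/andP; split.
    apply/hasPn => x; rewrite mem_cat mem_rev => xt.
    have ltx : lvl x < i by case/orP: xt => [/mb|/(climb_mem ha)] [] s []; lia.
    rewrite inE; apply/norP; split; first by apply: contraTneq ltx => ->; lia.
    by apply: contraL ltx => /lvlp; rewrite -leqNgt.
  apply/hasPn => x; rewrite mem_rev => /(climb_mem ha)[s [sj xa ls]].
  apply/negP => /mb[r [rj xb lr]].
  (* By levels, a common vertex lies equally many generations above [a] and [b]; from there on the
     two climbs agree, against [neq_ab]. *)
  have rs : r = s by lia.
  move: neq_ab; rewrite -(subnK (n := j) (m := s)); last by lia.
  by rewrite !iterD -xa xb rs eqxx.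
- rewrite cat_cons /cycle rcons_cat cat_path pp lastp rcons_cat cat_path climb_path //=.
  rewrite last_traject -iterSr -eq_ab.
  rewrite -rev_cons.
  have -> : a :: traject par (par a) j = belast a (traject par (par a) j.+1).
    by rewrite trajectSr belast_rcons.
  have -> : iter j.+1 par a = last a (traject par (par a) j.+1).
    by rewrite trajectSr last_rcons iterSr.
  rewrite rev_path (eq_path (e' := h)); last by move=> x y; rewrite /= h_sym.
  by apply: climb_path; lia.
- by rewrite !size_cat /= size_rev !size_traject; lia.
Qed.

(* Induction on the height [j] of [y] above [L]: if few edges are spread over several children of [y], sending each vertex of [Z] to its most frequent child leaves one child with at least half of the required density. *)
Lemma layered_cycle (k j : nat) (y : T) (L Z : {set T}) :
  j <= i -> j < k ->
  {in L, forall x, lvl x = i} -> {in Z, forall x, lvl x = i.+1} ->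
  {in L, forall x, iter j par x = y} ->
  2 ^ j * (2 * k) * (#|L| + #|Z|) < \sum_(z in Z) #|nbrs_in L z| ->
  exists c, [/\ uniq c, cycle h c & size c = 2 * k].
Proof.
elim: j y L Z => [|j IHj] y L Z ji jk lL lZ hy big.
  (* At height 0 only [y] itself can be in [L], so each vertex of [Z] has at most one neighbour
     there, against the density. *)
  exfalso; have L1 : #|L| <= 1.
    rewrite -(cards1 y); apply: subset_leq_card; apply/subsetP => x /hy xy.
    by rewrite inE -xy.
  have : \sum_(z in Z) #|nbrs_in L z| <= #|Z|.
    rewrite -sum1_card; apply: leq_sum => z _; apply: leq_trans L1.
    by apply: subset_leq_card; apply/subsetP => a; rewrite inE => /andP[].
  by move: big; rewrite expn0; nia.
have tc : 2 * k <= 2 ^ j * (2 * k) by rewrite leq_pmull // expn_gt0.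
pose chi := fun x => iter j par x.
have Esum : \sum_(z in Z) #|nbrs_in L z| =
    \sum_(z in Z) spread chi L z + \sum_(z in Z) max_class chi L z.
  by rewrite -big_split /=; apply: eq_bigr => z _; rewrite subnK // max_class_le.
have [sp|sp] := ltnP (2 * k * (#|L| + #|Z|)) (\sum_(z in Z) spread chi L z).
  have [L' [Z' [LL ZZ Z0 hZ hL]]] := prune_spread sp.
  have dLZ : [disjoint L' & Z'].
    apply/pred0P => x /=; apply/negbTE/negP => /andP[/(subsetP LL)/lL xi /(subsetP ZZ)/lZ].
    by rewrite xi; lia.
  have [z zZ] := set0Pn _ Z0.
  have [a] : exists a, a \in L'.
    have : 0 < #|nbrs_in L' z|.
      by have := hZ z zZ; rewrite /spread; lia.
    by rewrite card_gt0 => /set0Pn[a]; rewrite inE => /andP[aL _]; exists a.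
  move=> aL.
  (* The length [2 * (k - j.+1)] is the one that the [2 * j + 2] edges added by [close_cycle]
     complete to [2 * k]. It is positive, so the ends of the path descend from different children of
     [y]. *)
  have [|p [pp szp up subp [lp chip]]] := @zigzag_path _ chi (2 * k) (k - j.+1) L' Z' a dLZ aL _ hZ hL.
    by lia.
  have lvla := lL _ (subsetP LL _ aL).
  have lvlb := lL _ (subsetP LL _ lp).
  have lvlp : {in p, forall x, i <= lvl x}.
    by move=> x /subp; rewrite inE => /orP[/(subsetP LL)/lL->//|/(subsetP ZZ)/lZ->].
  have neq : iter j par a != iter j par (last a p) by rewrite eq_sym chip // subn_gt0.
  have eqi : iter j.+1 par a = iter j.+1 par (last a p).
    by rewrite (hy _ (subsetP LL _ aL)) (hy _ (subsetP LL _ lp)).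
  have [c [uc cc sc]] := close_cycle ji pp erefl up lvlp lvla lvlb neq eqi.
  by exists c; split => //; rewrite sc szp -[(2 * j).+2]/(2 + 2 * j) -mulnS -mulnDr subnK // ltnW.
(* The spread part is at most half of the required total, so keeping only the most frequent class of
   each vertex costs the factor 2 between [2 ^ j.+1] and [2 ^ j]. *)
have {}big : 2 ^ j * (2 * k) * (#|L| + #|Z|) < \sum_(z in Z) max_class chi L z.
  move: big; rewrite Esum expnS; nia.
pose top z := [arg max_(c > y) #|nbrs_class chi L z c|].
have topE z : max_class chi L z = #|nbrs_class chi L z (top z)|.
  rewrite /top; case: arg_maxnP => // c _ hc; apply/eqP; rewrite eqn_leq.
  apply/andP; split; first by apply/bigmax_leqP => d _; exact: hc.
  exact: (leq_bigmax (F := fun c => #|nbrs_class chi L z c|)).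
pose Lc c := [set x in L | chi x == c].
pose Zc c := [set z in Z | top z == c].
have EL : #|L| = \sum_c #|Lc c|.
  rewrite -sum1_card (partition_big chi predT) //=; apply: eq_bigr => c _.
  by rewrite -sum1_card; apply: eq_bigl => x; rewrite inE.
have EZ : #|Z| = \sum_c #|Zc c|.
  rewrite -sum1_card (partition_big top predT) //=; apply: eq_bigr => c _.
  by rewrite -sum1_card; apply: eq_bigl => x; rewrite inE.
have EM : \sum_(z in Z) max_class chi L z = \sum_c \sum_(z in Zc c) #|nbrs_in (Lc c) z|.
  rewrite (partition_big top predT) //=; apply: eq_bigr => c _.
  rewrite [RHS](eq_bigl (fun z => (z \in Z) && (top z == c))); last by move=> z; rewrite inE.
  apply: eq_bigr => z /andP[_ /eqP <-]; rewrite topE.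
  by congr #|pred_of_set _|; apply/setP => x; rewrite !inE andbAC.
(* The sets [Lc c] and [Zc c] partition [L] and [Z], so by averaging some child [c] keeps the
   density. *)
have [/existsP[c hc]|/existsPn noc] :=
  boolP [exists c, 2 ^ j * (2 * k) * (#|Lc c| + #|Zc c|) < \sum_(z in Zc c) #|nbrs_in (Lc c) z|].
  apply: (IHj c (Lc c) (Zc c)) => //; try lia.
  - by move=> x; rewrite inE => /andP[/lL].
  - by move=> x; rewrite inE => /andP[/lZ].
  - by move=> x; rewrite inE => /andP[_ /eqP].
exfalso; move: big; rewrite EM EL EZ -big_split /= big_distrr /= ltnNge => /negP; apply.
by apply: leq_sum => c _; rewrite leqNgt.
Qed.

End Tree.
End Layered.

(** * Growth of breadth-first layers *)

Lemma sum_nbrs_in_sym (T : finType) (h : rel T) (X Y : {set T}) :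
  symmetric h ->
  \sum_(x in X) #|nbrs_in h Y x| = \sum_(y in Y) #|nbrs_in h X y|.
Proof.
move=> h_sym.
have E (U W : {set T}) : \sum_(x in U) #|nbrs_in h W x| = \sum_(x in U) \sum_(y in W) h x y.
  apply: eq_bigr => x _; rewrite -sum1_card.
  rewrite (eq_bigl (fun y => (y \in W) && h x y)); last by move=> y; rewrite inE.
  by rewrite big_mkcondr; apply: eq_bigr => y _; case: (h x y).
rewrite !E exchange_big; apply: eq_bigr => y _; apply: eq_bigr => x _.
by rewrite h_sym.
Qed.

Section BFS.
Variables (T : finType) (h : rel T) (v : T) (K : nat).
Hypothesis h_sym : symmetric h.

Definition ball (i : nat) : {set T} :=
  iter i (fun S => S :|: [set y | [exists x in S, h x y]]) [set v].

(* Distance to [v], capped at [K + 1]. *)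
Definition bfs_lvl (x : T) : nat := find (fun i => x \in ball i) (iota 0 K.+1).

Lemma ball_mono i j : i <= j -> ball i \subset ball j.
Proof.
elim: j => [|j IHj]; first by rewrite leqn0 => /eqP ->.
rewrite leq_eqVlt => /orP[/eqP->//|/IHj ij].
by apply: (subset_trans ij); exact: subsetUl.
Qed.

Lemma bfs_lvl_le x i : i <= K -> (bfs_lvl x <= i) = (x \in ball i).
Proof.
move=> iK; apply/idP/idP => [li|xi].
  apply: (subsetP (ball_mono li)).
  have hx : has (fun i => x \in ball i) (iota 0 K.+1).
    by rewrite has_find size_iota ltnS (leq_trans li).
  have := nth_find 0 hx; rewrite nth_iota // ltnS.
  exact: leq_trans iK.
rewrite leqNgt; apply/negP => /(before_find 0).
by rewrite nth_iota ?ltnS // add0n xi.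
Qed.

Lemma bfs_lvl0 x : (bfs_lvl x == 0) = (x == v).
Proof. by rewrite -leqn0 bfs_lvl_le // inE. Qed.

Lemma bfs_lvl_edge x y : h x y -> bfs_lvl y <= (bfs_lvl x).+1.
Proof.
move=> hxy; have [Kx|xK] := leqP K (bfs_lvl x).
  by apply: leq_trans (find_size _ _) _; rewrite size_iota.
rewrite bfs_lvl_le // /ball iterS inE; apply/orP; right; rewrite inE.
by apply/existsP; exists x; rewrite hxy andbT -/(ball _) -bfs_lvl_le // ltnW.
Qed.

Lemma bfs_lvl_pred x : 0 < bfs_lvl x <= K ->
  exists2 y, h x y & (bfs_lvl y).+1 = bfs_lvl x.
Proof.
case E : (bfs_lvl x) => [//|m] /= mK.
have : x \in ball m.+1 by rewrite -bfs_lvl_le // E.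
rewrite /ball iterS inE -/(ball m) -bfs_lvl_le ?E ?ltnn /=; last exact: ltnW.
rewrite inE => /existsP[y /andP[ym hyx]]; exists y; first by rewrite h_sym.
rewrite -bfs_lvl_le ?(ltnW mK) // in ym.
by have := bfs_lvl_edge hyx; rewrite E ltnS => my; congr _.+1; apply/eqP; rewrite eqn_leq ym.
Qed.

(** The default [x] can occur only at the root or beyond the cap [K], where no parent is ever
    required. *)
Definition bfs_par (x : T) : T :=
  odflt x [pick y | h x y && ((bfs_lvl y).+1 == bfs_lvl x)].

Lemma bfs_parP x : 0 < bfs_lvl x <= K ->
  h x (bfs_par x) /\ (bfs_lvl (bfs_par x)).+1 = bfs_lvl x.
Proof.
move=> /bfs_lvl_pred[y hy ly]; rewrite /bfs_par; case: pickP => [z /andP[? /eqP]//|].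
by move/(_ y); rewrite hy ly eqxx.
Qed.

Definition layer (m : nat) : {set T} := [set x | bfs_lvl x == m].

(** All of layer [m] descends from the root in [m] generations, so [layered_cycle] applies with
    [y := v] at height [m]; the bound [2 ^ k] makes the constant independent of [m]. *)
Lemma layer_edges m k : m < k -> m <= K ->
  (forall c, uniq c -> cycle h c -> size c <> 2 * k) ->
  \sum_(z in layer m.+1) #|nbrs_in h (layer m) z| <=
    2 ^ k * (2 * k) * (#|layer m| + #|layer m.+1|).
Proof.
move=> mk mK nocyc; rewrite leqNgt; apply/negP => big.
have [] := @layered_cycle T h h_sym bfs_lvl bfs_par m _ _ k m v (layer m) (layer m.+1).
- by move=> x /andP[x0 xm]; have [] := @bfs_parP x; rewrite ?x0 ?(leq_trans xm).
- by move=> x /andP[x0 xm]; have [] := @bfs_parP x; rewrite ?x0 ?(leq_trans xm).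
- exact: leqnn.
- exact: mk.
- by move=> x; rewrite inE => /eqP.
- by move=> x; rewrite inE => /eqP.
- move=> x; rewrite inE => /eqP xm; apply/eqP; rewrite -bfs_lvl0.
  have : bfs_lvl (iter m bfs_par x) + m = bfs_lvl x.
    apply: (@lvl_iter_par T bfs_lvl bfs_par m); last by rewrite xm leqnn.
    by move=> z /andP[z0 zm]; have [] := @bfs_parP z; rewrite ?z0 ?(leq_trans zm).
  by rewrite xm => /eqP; rewrite -[X in _ == X]add0n eqn_add2r.
- apply: leq_ltn_trans big; rewrite leq_mul2r; apply/orP; right.
  by rewrite leq_mul2r leq_exp2l // (ltnW mk) orbT.
by move=> c [uc cc]; exact: nocyc.
Qed.

End BFS.

Section Growth.
Variables (R : realFieldType) (T : finType) (h : rel T) (k : nat).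
Variables (A B : {set T}) (b : bool -> R).
Hypothesis h_sym : symmetric h.
Hypothesis nocyc : forall c, uniq c -> cycle h c -> size c <> 2 * k.
Hypothesis dAB : [disjoint A & B].
Hypothesis hAB : forall x y, h x y -> (x \in A) && (y \in B) || (x \in B) && (y \in A).
Hypothesis degA : forall x, x \in A -> (b false <= #|nbrs_in h setT x|%:R)%R.
Hypothesis degB : forall x, x \in B -> (b true <= #|nbrs_in h setT x|%:R)%R.
Let c : R := (2 ^ k * (2 * k))%:R%R.
Hypothesis b_large : forall s, (6 * c <= b s)%R.
Hypothesis k_gt0 : 0 < k.
Variable v : T.
Hypothesis vA : v \in A.

Let lvl := bfs_lvl h v k.
Let N := layer h v k.

(** Edges change sides and the root is in [A], so sides alternate with the level; this is why the
    degree bounds [b] are indexed by a parity. *)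
Lemma layer_side x : lvl x <= k -> x \in (if odd (lvl x) then B else A).
Proof.
move E : (lvl x) => m; elim: m x E => [|m IHm] x E mk.
  by move/eqP: E; rewrite bfs_lvl0 => /eqP ->.
have [|y hxy] := @bfs_lvl_pred T h v k h_sym x; first by rewrite -/lvl E mk.
rewrite -/lvl E => -[ly]; have /= := IHm y ly (ltnW mk).
have /orP[/andP[xA yB]|/andP[xB yA]] := hAB hxy; case: (odd m) => //=.
- by move=> yA; have := disjointFr dAB yA; rewrite yB.
- by move=> yB; have := disjointFr dAB yA; rewrite yB.
Qed.

(** A layer lies on one side and so spans no edge: all neighbours are one level up or down. The
    factor [0 < m] discards the truncated predecessor of layer 0. *)
Lemma layer_deg m x : m < k -> x \in N m ->
  (b (odd m) <= (#|nbrs_in h (N m.+1) x| + (0 < m) * #|nbrs_in h (N m.-1) x|)%:R)%R.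
Proof.
move=> mk; rewrite inE => /eqP xm.
have side := @layer_side x; rewrite /lvl xm in side.
have := side (ltnW mk).
have : #|nbrs_in h setT x| <= #|nbrs_in h (N m.+1) x| + (0 < m) * #|nbrs_in h (N m.-1) x|.
  have [m0|m0] := posnP m.
    rewrite mul0n addn0; apply: subset_leq_card; apply/subsetP => y; rewrite !inE /= => hxy.
    rewrite hxy andbT; have := bfs_lvl_edge v k hxy; rewrite xm m0.
    case E : (bfs_lvl h v k y) => [|[|]] // _.
    move/eqP: E; rewrite bfs_lvl0 => /eqP yv; move/eqP: xm; rewrite m0 bfs_lvl0 => /eqP xv.
    move: hxy; rewrite yv xv => /hAB; rewrite vA.
    by have := disjointFr dAB vA => ->.
  rewrite mul1n; apply: leq_trans (leq_card_setU _ _).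
  apply: subset_leq_card; apply/subsetP => y; rewrite !inE /= => hxy; rewrite hxy !andbT.
  have := bfs_lvl_edge v k hxy; rewrite xm.
  have hyx : h y x by rewrite h_sym.
  have := bfs_lvl_edge v k hyx; rewrite xm.
  have [ym|ym] := eqVneq (bfs_lvl h v k y) m; last by lia.
  have := @layer_side y; rewrite /lvl ym => /(_ (ltnW mk)); have := side (ltnW mk).
  have /orP[/andP[xA yB]|/andP[xB yA]] := hAB hxy; case: (odd m) => //=.
  - by have := disjointFr dAB xA => ->.
  - by move=> _ yA; have := disjointFr dAB yA; rewrite yB.
  - by move=> _ yB; have := disjointFr dAB yA; rewrite yB.
  - by move=> xA; have := disjointFr dAB xA; rewrite xB.
rewrite -(ler_nat R) => le1; case: (odd m) => [/degB|/degA] le2; exact: le_trans le2 le1.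
Qed.

(** Let w, x, y be the sizes of layers m - 1, m, m + 1. Counting the edges at layer m gives b x <= c
    (w + x) + c (x + y), and w <= x by induction, so b x <= 3 c x + c y. As b >= 6 c, this yields 3
    x <= y, hence also b x <= 2 c y. *)
Lemma layer_growth m : m < k ->
  ((b (odd m) * #|N m|%:R <= 2 * c * #|N m.+1|%:R) /\ (#|N m|%:R <= #|N m.+1|%:R :> R))%R.
Proof.
have c0 : (0 < c)%R by rewrite ltr0n !muln_gt0 expn_gt0 k_gt0.
have step (l : nat) : l < k ->
    ((b (odd l) * #|N l|%:R <= c * (#|N l|%:R + #|N l.+1|%:R) +
      (0 < l)%:R * (c * (#|N l.-1|%:R + #|N l|%:R))))%R.
  move=> lk.
  have H : (b (odd l) * #|N l|%:R <= \sum_(x in N l) (#|nbrs_in h (N l.+1) x| + (0 < l) * #|nbrs_in h (N l.-1) x|)%:R)%R.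
    rewrite mulr_natr -sumr_const; apply: ler_sum => x xl; exact: layer_deg.
  apply: le_trans H _; rewrite -natr_sum big_split /= natrD; apply: lerD.
    rewrite sum_nbrs_in_sym // -natrD -natrM ler_nat.
    by apply: layer_edges => //; exact: ltnW.
  case: l lk => [|l] lk.
    by rewrite mul0r big1 // => i _; rewrite mul0n.
  rewrite mul1r -natrD -natrM ler_nat.
  under eq_bigr do rewrite mul1n.
  have lk1 := ltnW lk; by apply: layer_edges => //; exact: ltnW.
have bl s : (6 * c <= b s)%R by [].
elim: m => [|m IHm] mk; have := step _ mk; rewrite ?mul0r ?addr0 ?mul1r /=.
  move: (bl false); move: (#|N 0|%:R : R)%R (ler0n R #|N 0|) => x x0.
  move: (#|N 1|%:R : R)%R (ler0n R #|N 1|) => y y0 b0 H.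
  have : (6 * c * x <= c * (x + y))%R by apply: le_trans H; rewrite ler_wpM2r.
  move=> H2; have xy : (x <= y)%R by rewrite -(ler_pM2l c0); nra.
  by split=> //; apply: le_trans H _; nra.
have [_ ] := IHm (ltnW mk).
move: (bl (~~ odd m)); move: (#|N m|%:R : R)%R (ler0n R #|N m|) => w w0.
move: (#|N m.+1|%:R : R)%R (ler0n R #|N m.+1|) => x x0.
move: (#|N m.+2|%:R : R)%R (ler0n R #|N m.+2|) => y y0 b0 wx H.
have H3 : (6 * c * x <= b (~~ odd m) * x)%R by rewrite ler_wpM2r.
have H4 : (c * w <= c * x)%R by rewrite ler_wpM2l // ltW.
have xy : (x <= y)%R by rewrite -(ler_pM2l c0); nra.
by split=> //; nra.
Qed.

(** Multiply the growth inequalities, starting from the single vertex of layer 0; the last layer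
    fits in the side determined by the parity of [k]. *)
Lemma bipartite_growth :
  (\prod_(i < k) b (odd i) <= (2 * c) ^+ k * #|if odd k then B else A|%:R)%R.
Proof.
have c0 : (0 < c)%R by rewrite ltr0n !muln_gt0 expn_gt0 k_gt0.
have H m : m <= k -> (\prod_(i < m) b (odd i) <= (2 * c) ^+ m * #|N m|%:R)%R.
  elim: m => [|m IHm] mk.
    rewrite big_ord0 expr0 mul1r ler1n card_gt0; apply/set0Pn; exists v.
    by rewrite inE bfs_lvl0.
  have [H1 _] := layer_growth mk; rewrite big_ord_recr /= exprSr -mulrA.
  apply: le_trans (ler_wpM2l _ H1); last by rewrite exprn_ge0 // mulr_ge0 // ltW.
  rewrite mulrCA mulrC ler_wpM2l //; last exact: IHm (ltnW mk).
  by apply: le_trans (b_large _); rewrite mulr_ge0 // ltW.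
apply: le_trans (H k (leqnn k)) _.
rewrite ler_wpM2l ?exprn_ge0 ?mulr_ge0 ?(ltW c0) // ler_nat.
apply: subset_leq_card; apply/subsetP => x; rewrite inE => /eqP xk.
by have := @layer_side x; rewrite /lvl xk leqnn => /(_ isT).
Qed.

End Growth.

(** * The number of vertices of large degree *)

(** The sets containing [x] but not [y] are the [x |: Y] with [Y] avoiding both, a quarter of all
    subsets. *)
Lemma card_separating_sets (T : finType) (x y : T) :
  x != y -> 2 ^ #|T| <= 4 * #|[set X : {set T} | (x \in X) && (y \notin X)]|.
Proof.
move=> xy.
have E : #|T| = (#|~: [set x; y]|).+2.
  by have := cardsC [set x; y]; rewrite cards2 xy => <-.
rewrite E !expnS mulnA leq_mul2l /= -card_powerset.
rewrite -(@card_in_imset _ _ (fun Y => x |: Y)); last first.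
  move=> Y Z; rewrite !inE => /subsetP hY /subsetP hZ /setP eYZ; apply/setP => z.
  have [->|zx] := eqVneq z x.
    have -> : (x \in Y) = false by apply/negP => /hY; rewrite !inE eqxx.
    by have -> : (x \in Z) = false by apply/negP => /hZ; rewrite !inE eqxx.
  by have := eYZ z; rewrite !inE (negbTE zx).
apply: subset_leq_card; apply/subsetP => X /imsetP[Y] + ->; rewrite powersetE => /subsetP hY.
rewrite !inE eqxx eq_sym (negbTE xy) /=; apply/negP => /hY.
by rewrite !inE eqxx orbT.
Qed.

(** Averaging over all [X]: each adjacent pair with first vertex in [A] is separated in the given
    order by a quarter of the sets. *)
Lemma exists_split (T : finType) (e : rel T) (A : {set T}) :
  irreflexive e ->
  exists X : {set T}, \sum_(x in A) #|nbrs_in e setT x| <=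
    4 * \sum_(x in A :&: X) #|nbrs_in e (~: X) x|.
Proof.
move=> e_irr; apply/existsP; apply: contraT => /existsPn noX; exfalso.
pose f (X : {set T}) := \sum_(x in A :&: X) #|nbrs_in e (~: X) x|.
set P := \sum_(x in A) _ in noX.
have fE X : f X = \sum_(x in A) \sum_(y | e x y) ((x \in X) && (y \notin X)).
  rewrite /f (eq_bigl (fun x => (x \in A) && (x \in X))); last by move=> x; rewrite inE.
  rewrite big_mkcondr; apply: eq_bigr => x _; case: (x \in X) => /=; last by rewrite big1.
  rewrite -sum1_card (eq_bigl (fun y => e x y && (y \notin X))); last first.
    by move=> y; rewrite !inE andbC.
  by rewrite big_mkcondr; apply: eq_bigr => y _; case: (y \in X).
have sumf : 2 ^ #|T| * P <= 4 * \sum_X f X.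
  under eq_bigr do rewrite fE.
  rewrite exchange_big /P !big_distrr /=; apply: leq_sum => x _.
  rewrite exchange_big -[X in _ * X <= _]sum1_card !big_distrr /=.
  rewrite (eq_bigl (e x)); last by move=> y; rewrite !inE.
  apply: leq_sum => y exy; rewrite muln1.
  have xy : x != y by apply: contraTneq exy => ->; rewrite e_irr.
  apply: leq_trans (card_separating_sets xy) _; rewrite leq_mul2l /= -sum1_card.
  rewrite [X in X <= _](eq_bigl (fun X : {set T} => predT X && ((x \in X) && (y \notin X)))); last first.
    by move=> X; rewrite inE.
  by rewrite big_mkcondr; apply: leq_sum => X _; case: (_ && _).
have : 4 * \sum_X f X < 2 ^ #|T| * P.
  rewrite big_distrr /=.
  have -> : 2 ^ #|T| * P = \sum_(X : {set T}) P.
    by rewrite sum_nat_const -[#|T|]cardsT -card_powerset powersetT cardsT.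
  have lt X : 4 * f X < P by rewrite ltnNge; exact: noX.
  rewrite (bigD1 set0) // [X in _ < X](bigD1 set0) //= -addSn leq_add //.
  by apply: leq_sum => X _; exact: ltnW.
by rewrite ltnNge sumf.
Qed.

Section Prune.
Variables (R : realFieldType) (T : finType) (e : rel T) (al be : R).
Hypothesis e_sym : symmetric e.

(** Deleting a vertex of degree below [al] in [A], or below [be] in [B], lowers the edge count by
    less than it lowers the left-hand side, so the inequality survives; it fails once [A] is
    empty. *)
Lemma prune_bipartite (A B : {set T}) : (0 <= be)%R ->
  (al * #|A|%:R + be * #|B|%:R < (\sum_(x in A) #|nbrs_in e B x|)%:R)%R ->
  exists A' B' : {set T}, [/\ A' \subset A, B' \subset B, A' != set0,
    {in A', forall x, al <= #|nbrs_in e B' x|%:R}%R &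
    {in B', forall x, be <= #|nbrs_in e A' x|%:R}%R].
Proof.
move=> be0; move: {2}(_ + _) (leqnn (#|A| + #|B|)) => m.
elim: m => [|m IHm] in A B *.
  rewrite leqn0 addn_eq0 !cards_eq0 => /andP[/eqP -> /eqP ->].
  by rewrite big_set0 cards0 !mulr0 addr0 ltxx.
move=> szm big.
have rem (X Y : {set T}) (x : T) : x \in X ->
    \sum_(z in X) #|nbrs_in e Y z| = \sum_(z in X :\ x) #|nbrs_in e Y z| + #|nbrs_in e Y x|.
  by move=> xX; rewrite (big_setD1 x) //= addnC.
have [x /andP[xA xt]|noA] := pickP [pred x in A | (#|nbrs_in e B x|%:R < al)%R].
  have Ax : #|A| = #|A :\ x|.+1 by rewrite (cardsD1 x) xA.
  have [||A' [B' [AA BB H1 H2 H3]]] := IHm (A :\ x) B.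
  - by move: szm; rewrite Ax addSn ltnS.
  - move: big; rewrite (rem _ _ _ xA) Ax natrD -natr1; lra.
  - by exists A', B'; split=> //; apply: (subset_trans AA); exact: subD1set.
have [x /andP[xB xt]|noB] := pickP [pred x in B | (#|nbrs_in e A x|%:R < be)%R].
  have Bx : #|B| = #|B :\ x|.+1 by rewrite (cardsD1 x) xB.
  have [||A' [B' [AA BB H1 H2 H3]]] := IHm A (B :\ x).
  - by move: szm; rewrite Bx addnS ltnS.
  - move: big; rewrite sum_nbrs_in_sym // (rem _ _ _ xB) -(sum_nbrs_in_sym A) // Bx natrD -natr1; lra.
  - by exists A', B'; split=> //; apply: (subset_trans BB); exact: subD1set.
have degA : {in A, forall x, al <= #|nbrs_in e B x|%:R}%R.
  by move=> x xA; have := noA x; rewrite /= xA /= ltNge => /negbFE.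
have degB : {in B, forall x, be <= #|nbrs_in e A x|%:R}%R.
  by move=> x xB; have := noB x; rewrite /= xB /= ltNge => /negbFE.
exists A, B; split=> //.
apply: contraTneq big => A0; rewrite -leNgt A0 big_set0 cards0 mulr0 add0r.
by rewrite mulr_ge0.
Qed.

End Prune.

Section DegreeTail.
Variables (R : realFieldType) (T : finType) (e : rel T) (k : nat).
Hypothesis e_sym : symmetric e.
Hypothesis e_irr : irreflexive e.
Hypothesis k_gt1 : 1 < k.
Hypothesis nocyc : forall c, uniq c -> cycle e c -> size c <> 2 * k.

Let c : R := (2 ^ k * (2 * k))%:R%R.
Let n : R := #|T|%:R%R.

(** A split keeps at least a quarter of the at least |A| D incidences. The thresholds al = D / 16
    and be = |A| D / (16 n) satisfy be n = al |A| = |A| D / 16, so pruning with them is possible and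
    the growth bound applies. The size hypothesis says exactly that be >= 6 c, and al >= be because
    |A| <= n. *)
Lemma tail_expansion (A : {set T}) (D : R) :
  (0 < D)%R -> A != set0 -> {in A, forall x, D <= #|nbrs_in e setT x|%:R}%R ->
  (96 * c * n <= #|A|%:R * D)%R ->
  (\prod_(i < k) (if odd i then #|A|%:R * D / (16 * n) else D / 16) <=
    (2 * c) ^+ k * (if odd k then n else #|A|%:R))%R.
Proof.
move=> D0 A0 degA big.
have c0 : (0 < c)%R by rewrite ltr0n !muln_gt0 expn_gt0 (ltnW k_gt1).
have t0 : (0 < #|A|%:R :> R)%R by rewrite ltr0n card_gt0.
have tn : (#|A|%:R <= n)%R by rewrite ler_nat max_card.
have n0 : (0 < n)%R by exact: lt_le_trans tn.
have [X hX] := exists_split A e_irr.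
set al : R := (D / 16)%R; set be : R := (#|A|%:R * D / (16 * n))%R.
have ben : (be * n = al * #|A|%:R)%R.
  by rewrite /be /al; field; rewrite gt_eqF.
have al0 : (0 < al)%R by rewrite divr_gt0.
have be0 : (0 < be)%R by rewrite divr_gt0 ?mulr_gt0.
have be_large : (6 * c <= be)%R.
  by rewrite /be ler_pdivlMr ?mulr_gt0 //; lra.
have al_large : (6 * c <= al)%R.
  apply: le_trans be_large _; rewrite -(ler_pM2r n0) ben.
  by rewrite ler_pM2l.
have [|A' [B' [AA BB A'0 dA dB]]] :=
    @prune_bipartite R T e al be e_sym (A :&: X) (~: X) (ltW be0).
  have H1 : (#|A|%:R * D <= (\sum_(x in A) #|nbrs_in e setT x|)%:R)%R.
    rewrite natr_sum mulr_natl -sumr_const; apply: ler_sum => x xA; exact: degA.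
  move: hX; rewrite -(ler_nat R) natrM => hX.
  have H2 : (al * #|A :&: X|%:R <= al * #|A|%:R)%R.
    by rewrite ler_pM2l // ler_nat subset_leq_card // subsetIl.
  have H3 : (be * #|~: X|%:R <= be * n)%R.
    by rewrite ler_pM2l // ler_nat max_card.
  have : (0 < #|A|%:R * D)%R by rewrite mulr_gt0.
  by move: H3; rewrite ben /al in H2 *; lra.
have [v vA] := set0Pn _ A'0.
have dAB : [disjoint A' & B'].
  apply/pred0P => x /=; apply/negbTE/negP => /andP[/(subsetP AA) + /(subsetP BB)].
  by rewrite !inE => /andP[_ ->].
pose h x y := e x y && ((x \in A') && (y \in B') || (x \in B') && (y \in A')).
have h_sym : symmetric h by move=> x y; rewrite /h e_sym orbC ![(y \in _) && _]andbC.
have := @bipartite_growth R T h k A' B' (fun s => if s then be else al) h_sym.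
move=> /(_ _ dAB _ _ _ _ (ltnW k_gt1) v vA).
move=> H; apply: le_trans (H _ _ _ _ _) _.
- move=> s us cs; apply: nocyc => //; apply: sub_cycle cs.
  by move=> x y /andP[].
- by move=> x y /andP[].
- move=> x xA; apply: le_trans (dA x xA) _; rewrite ler_nat; apply: subset_leq_card.
  by apply/subsetP => y; rewrite !inE /h xA => /andP[-> ->].
- move=> x xB; apply: le_trans (dB x xB) _; rewrite ler_nat; apply: subset_leq_card.
  by apply/subsetP => y; rewrite !inE /h xB => /andP[-> ->]; rewrite orbT.
- by case.
rewrite ler_wpM2l ?exprn_ge0 ?mulr_ge0 ?(ltW c0) //.
case: (odd k); rewrite ler_nat ?max_card //.
by apply: subset_leq_card; apply: (subset_trans AA); exact: subsetIl.
Qed.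

Lemma prod_alternating (x y : R) m :
  (\prod_(i < m) (if odd i then y else x) = x ^+ (uphalf m) * y ^+ m./2)%R.
Proof.
elim: m => [|m IHm]; first by rewrite big_ord0 !expr0 mulr1.
rewrite big_ord_recr /= {}IHm uphalf_half.
by case: (odd m); rewrite /= ?add0n ?add1n !exprS; ring.
Qed.

(** This is the tail bound for the number of vertices of degree at least [D]. It is immediate from
    [D <= n] when |A| D is below 96 c n; otherwise it follows from [tail_expansion]. *)
Lemma degree_tail (A : {set T}) (D : R) :
  (0 <= D)%R -> {in A, forall x, D <= #|nbrs_in e setT x|%:R}%R ->
  (#|A|%:R ^+ k.-1 * D ^+ k <= (96 * c) ^+ k * n ^+ k)%R.
Proof.
move=> D0 degA.
have c1 : (1 <= c)%R by rewrite ler1n !muln_gt0 expn_gt0 (ltnW k_gt1).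
have rhs0 : (0 <= (96 * c) ^+ k * n ^+ k)%R.
  by rewrite mulr_ge0 ?exprn_ge0 ?ler0n // mulr_ge0 //; lra.
have [->|A0] := eqVneq A set0.
  by rewrite cards0 expr0n -{1}(subnKC k_gt1) /= mul0r.
have [->|Dn0] := eqVneq D 0%R.
  by rewrite expr0n -{2}(subnKC k_gt1) /= mulr0.
have {D0 Dn0}D0 : (0 < D)%R by rewrite lt_neqAle eq_sym Dn0.
have t0 : (0 < #|A|%:R :> R)%R by rewrite ltr0n card_gt0.
have tn : (#|A|%:R <= n)%R by rewrite ler_nat max_card.
have n0 : (0 < n)%R by exact: lt_le_trans tn.
have [small|big] := ltP (#|A|%:R * D)%R (96 * c * n)%R.
  have [x xA] := set0Pn _ A0.
  have Dn : (D <= n)%R by apply: le_trans (degA x xA) _; rewrite ler_nat max_card.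
  have -> : (D ^+ k = D ^+ k.-1 * D)%R by rewrite -exprSr (ltn_predK k_gt1).
  rewrite mulrA -exprMn.
  have -> : ((96 * c) ^+ k * n ^+ k = (96 * c * n) ^+ k.-1 * (96 * c * n))%R.
    by rewrite -exprMn -exprSr (ltn_predK k_gt1).
  apply: ler_pM; rewrite ?exprn_ge0 ?mulr_ge0 ?(ltW t0) ?(ltW D0) //.
    by rewrite lerXn2r ?nnegrE ?(ltW small) ?mulr_ge0 ?ltW //; lra.
  by apply: le_trans Dn _; rewrite ler_peMl ?(ltW n0) //; lra.
have := tail_expansion D0 A0 degA big.
move: (#|A|%:R)%R t0 tn {big} => t t0 tn.
rewrite prod_alternating => H.
have E16 : (t * D / (16 * n) = t * (D / 16) / n)%R by field; rewrite gt_eqF.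
have hk : (uphalf k + k./2 = k)%N by rewrite uphalf_half -addnA addnn odd_double_half.
(* Clearing the denominators [16] turns [2 * c] into [32 * c]. *)
have {}H : (D ^+ k * t ^+ k./2 <= (32 * c) ^+ k * (n ^+ k./2 * (if odd k then n else t)))%R.
  move: H; rewrite E16.
  have E u l : ((D / 16) ^+ u * (t * (D / 16) / n) ^+ l =
      D ^+ (u + l) * t ^+ l / (16 ^+ (u + l) * n ^+ l) :> R)%R.
    rewrite !exprMn !exprVn !exprD; field.
    by rewrite !expf_neq0 // gt_eqF.
  rewrite {}E hk.
  rewrite ler_pdivrMr ?mulr_gt0 ?exprn_gt0 // => H.
  apply: le_trans H _; rewrite (_ : 32 = 2 * 16)%R; last by ring.
  by rewrite !exprMn le_eqVlt; apply/orP; left; apply/eqP; ring.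
have {}H : (t ^+ k.-1 * D ^+ k <= (32 * c) ^+ k * n ^+ k)%R.
  (* Multiply by the missing power of [t] and use [t <= n]: for odd [k] it is [t ^+ k./2], while for
     even [k] the factor [t] on the right completes it to [t ^+ k./2]. *)
  have kE : (k.-1 = k./2 + (k.-1 - k./2))%N by rewrite subnKC //; move: k_gt1; clear; lia.
  rewrite kE exprD mulrC mulrA.
  apply: le_trans (ler_wpM2r _ H) _; first by rewrite exprn_ge0 // ltW.
  rewrite -mulrA ler_wpM2l ?exprn_ge0 ?mulr_ge0 ?ler0n //.
  have lerX m : (t ^+ m <= n ^+ m)%R by rewrite lerXn2r ?nnegrE ?(ltW t0) ?(ltW n0).
  case: ifP => ok.
    have -> : k.-1 - k./2 = k./2 by move: ok; clear; lia.
    have kk : k = (k./2).+1 + k./2 by move: ok; clear; lia.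
    rewrite [X in (_ <= _ ^+ X)%R]kk.
    by rewrite -exprSr exprD ler_wpM2l // exprn_ge0 // ltW.
  have kk : k = k./2 + k./2 by move: ok; clear; lia.
  rewrite [X in (_ <= _ ^+ X)%R]kk.
  rewrite -mulrA -exprS exprD ler_wpM2l // ?exprn_ge0 ?(ltW n0) //.
  by have -> : (k.-1 - k./2).+1 = k./2 by move: ok k_gt1; clear; lia.
apply: le_trans H _; rewrite ler_wpM2r ?exprn_ge0 ?(ltW n0) //.
by rewrite lerXn2r ?nnegrE ?ler_wpM2r ?mulr_ge0 ?ler0n ?ler_nat.
Qed.

End DegreeTail.

From mathcomp Require Import all_classical all_reals all_analysis.
(* Restores [Defs.free], shadowed by the linear-algebra [free]. *)
Import Defs.
Local Open Scope ring_scope.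

(** * Degree power sums *)

Lemma cycle_subgraph (G : sgraph) (c : seq G) :
  uniq c -> path.cycle (@edge G) c -> subgraph (cycle_graph (size c)) G.
Proof.
case: c => [_ _|x c uc /= /(pathP x) hc].
  (* The empty sequence corresponds to the empty map out of ['I_0]. *)
  have F (i : 'I_0) : False by case: i.
  by exists (fun i => match F i with end) => i; case: (F i).
have hc' i : (i < (size c).+1)%N ->
    edge (nth x (x :: c) i) (nth x (x :: c) (i.+1 %% (size c).+1)).
  move=> ic; have := hc i; rewrite size_rcons => /(_ ic).
  rewrite nth_rcons.
  move: ic; rewrite ltnS leq_eqVlt => /orP[/eqP->|ic].
    by rewrite ltnn eqxx modnn -[x :: rcons _ _]/(rcons (x :: c) x) nth_rcons /= ltnSn.
  by rewrite ic modn_small // -[x :: rcons _ _]/(rcons (x :: c) x) nth_rcons /= ltnS (ltnW ic).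
exists (fun i : 'I_(size (x :: c)) => nth x (x :: c) i).
  by move=> i j /eqP; rewrite nth_uniq // => /eqP/val_inj.
move=> i j /= /andP[_ /orP[]/eqP<-]; rewrite /= ?hc' //.
by rewrite edge_sym hc'.
Qed.

Lemma free_no_cycle (G : sgraph) k : free (cycle_graph k) G ->
  forall c : seq G, uniq c -> path.cycle (@edge G) c -> size c <> k.
Proof. by move=> F c uc cc sc; apply: F; rewrite -sc; exact: cycle_subgraph. Qed.

Lemma degE (G : sgraph) (v : G) : deg v = #|nbrs_in (@edge G) [set: G]%SET v|.
Proof. by rewrite /deg; apply: eq_card => w; rewrite !inE. Qed.

Lemma deg_le (G : sgraph) (v : G) : (deg v <= #|{: G}|)%N.
Proof. exact: max_card. Qed.

Section Powers.
Variable R : realType.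
Implicit Types (p x y : R).

Lemma sum_geom_le (x : R) m : 0 <= x < 1 -> \sum_(i < m) x ^+ i <= (1 - x)^-1.
Proof.
move=> /andP[x0 x1]; rewrite -[leRHS]div1r ler_pdivlMr ?subr_gt0 //.
have := subrX1 x m; set s := \sum_(i < m) _ => E.
have : 0 <= x ^+ m by rewrite exprn_ge0.
by rewrite mulrC -[1 - x]opprB mulNr -E; lra.
Qed.

Lemma powRX (x p : R) m : 0 <= x -> (x ^+ m) `^ p = (x `^ p) ^+ m.
Proof.
by move=> x0; rewrite -powR_mulrn // -powRrM mulrC powRrM powR_mulrn // powR_ge0.
Qed.

Lemma exponent_gt1 k p : (1 < k)%N -> k%:R / (k%:R - 1) < p -> 1 < p.
Proof.
move=> k1; apply: le_lt_trans.
have k1' : 1 < k%:R :> R by rewrite ltr1n.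
by rewrite ler_pdivlMr ?subr_gt0 // mul1r; lra.
Qed.

(** Dyadic summation: by [degree_tail] at most c^2 y^(j+1) vertices have degree at least n /
    2^(j+1), where y = 2^q, and those of degree at most n / 2^j contribute at most (n / 2^j)^p each.
    The resulting series has ratio 2^q / 2^p, which is below 1 exactly because p > q. *)
Lemma e_p_le (k : nat) (p : R) : (1 < k)%N -> k%:R / (k%:R - 1) < p ->
  exists2 C : R, 0 < C & forall G : sgraph, free (cycle_graph (2 * k)) G ->
    e_p p G <= C * #|{: G}|%:R `^ p.
Proof.
move=> k1 hp.
have p1 := exponent_gt1 k1 hp.
have k1' : 1 < k%:R :> R by rewrite ltr1n.
set q : R := k%:R / (k%:R - 1) in hp.
have [c c1 cE] : exists2 c : R, 1 <= c & c = 96 * (2 ^ k * (2 * k))%:R.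
  exists (96 * (2 ^ k * (2 * k))%:R) => //.
  by rewrite -natrM ler1n !muln_gt0 expn_gt0 (ltnW k1).
have c0 : 0 < c by apply: lt_le_trans c1.
pose y : R := 2 `^ q; pose u : R := 2 `^ p.
have y0 : 0 < y by rewrite powR_gt0.
have u0 : 0 < u by rewrite powR_gt0.
have yu : y < u.
  rewrite /y /u; have -> : p = q + (p - q) by ring.
  rewrite powRD; last by rewrite pnatr_eq0 implybT.
  rewrite ltr_pMr //; have E1 : 1 `^ (p - q) = 1 :> R by rewrite powR1.
  rewrite -[ltLHS]E1.
  by rewrite gt0_ltr_powR ?nnegrE ?subr_gt0 // ltr1n.
have yk : y ^+ k.-1 = 2 ^+ k.
  rewrite /y -powR_mulrn ?powR_ge0 // -powRrM -powR_mulrn //.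
  congr (_ `^ _); rewrite /q -subn1 natrB ?(ltnW k1) // divfK //.
  by rewrite subr_eq0 gt_eqF.
have r01 : 0 <= y / u < 1.
  by rewrite divr_ge0 ?(ltW y0) ?(ltW u0) //= ltr_pdivrMr // mul1r.
have C0 : 0 < c ^+ 2 * y / (1 - y / u).
  by case/andP: r01 => _ r1; rewrite divr_gt0 ?mulr_gt0 ?exprn_gt0 ?subr_gt0.
exists (c ^+ 2 * y / (1 - y / u)) => // G Gfree; set n := #|{: G}|.
have [n0|n0] := posnP n.
  rewrite /e_p big1; first by rewrite mulr_ge0 ?powR_ge0 ?ltW.
  by move=> v _; have := card0_eq n0 v; rewrite inE.
have n0' : 0 < n%:R :> R by rewrite ltr0n.
pose t j := [set v : G | n%:R / 2 ^+ j.+1 <= (deg v)%:R :> R].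
(* The square absorbs the (k - 1)-th root of c^k: since c >= 1 and k >= 2, c^k <= c^(2 (k - 1)). *)
have ht j : #|t j|%:R <= c ^+ 2 * y ^+ j.+1.
  have := @degree_tail R G (@edge G) k (@edge_sym G) (@edge_irrefl G) k1 (free_no_cycle Gfree) (t j) (n%:R / 2 ^+ j.+1).
  rewrite -cE.
  rewrite divr_ge0 ?exprn_ge0 ?ler0n // => /(_ isT) H.
  have {}H : #|t j|%:R ^+ k.-1 * (n%:R / 2 ^+ j.+1) ^+ k <= c ^+ k * n%:R ^+ k.
    by apply: H => v; rewrite inE degE.
  have E : (y ^+ j.+1) ^+ k.-1 = (2 ^+ j.+1) ^+ k.
    by rewrite exprAC yk exprAC.
  have kp : (0 < k.-1)%N by rewrite -subn1 subn_gt0.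
  rewrite -(ler_pXn2r kp) ?nnegrE ?mulr_ge0 ?exprn_ge0 ?(ltW y0) ?(ltW c0) ?ler0n //.
  rewrite exprMn E; move: H; rewrite exprMn exprVn; rewrite mulrA ler_pdivrMr ?exprn_gt0 //.
  rewrite mulrAC ler_pM2r ?exprn_gt0 // => H.
  apply: le_trans H _; rewrite ler_pM2r ?exprn_gt0 //.
  by rewrite -exprM ler_weXn2l //; move: k1; clear; lia.
(* The largest [j] with 2^j deg v <= n puts the degree between n / 2^(j+1) and n / 2^j. It is below
   [n] when the degree is positive, so [n] scales suffice. *)
have hv (v : G) : (deg v)%:R `^ p <= \sum_(j < n) (v \in t j)%:R * (n%:R / 2 ^+ j) `^ p.
  have [d0|d0] := posnP (deg v).
    rewrite d0 powR0; last by apply: lt0r_neq0; lra.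
    by apply: sumr_ge0 => j _; rewrite mulr_ge0 ?powR_ge0.
  have ex : exists j, (2 ^ j * deg v <= n)%N by exists 0%N; rewrite mul1n deg_le.
  have bd j : (2 ^ j * deg v <= n)%N -> (j <= n)%N.
    by move=> H; apply: ltnW; apply: leq_trans (ltn_expl j (ltnSn 1)) _; apply: leq_trans H; rewrite leq_pmulr.
  case: (ex_maxnP ex bd) => j hj maxj.
  have jn : (j < n)%N.
    by apply: leq_trans (ltn_expl j (ltnSn 1)) _; apply: leq_trans hj; rewrite leq_pmulr.
  rewrite (bigD1 (Ordinal jn)) //= -[leLHS]addr0 lerD //; last first.
    by apply: sumr_ge0 => l _; rewrite mulr_ge0 ?powR_ge0.
  have -> : v \in t j.
    rewrite inE ler_pdivrMr ?exprn_gt0 // -natrX -natrM ler_nat mulnC leqNgt.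
    by apply/negP => H; have := maxj _ (ltnW H); rewrite ltnn.
  rewrite mul1r ge0_ler_powR ?nnegrE ?divr_ge0 ?exprn_ge0 ?ler0n //; first lra.
  by rewrite ler_pdivlMr ?exprn_gt0 // -natrX -natrM ler_nat mulnC.
apply: le_trans (ler_sum _ (fun v _ => hv v)) _.
rewrite exchange_big /=.
have hj (j : 'I_n) : \sum_(v : G) (v \in t j)%:R * (n%:R / 2 ^+ j) `^ p <=
    c ^+ 2 * y * n%:R `^ p * (y / u) ^+ j.
  rewrite -mulr_suml -natr_sum.
  have -> : (\sum_(v : G) (v \in t j) = #|t j|)%N by rewrite -sum1_card [RHS]big_mkcond; apply: eq_bigr => v _; case: (v \in t j).
  apply: le_trans (ler_wpM2r (powR_ge0 _ _) (ht j)) _.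
  rewrite powRM ?invr_ge0 ?exprn_ge0 ?ler0n //.
  have -> : ((2 ^+ j)^-1 `^ p = (u ^+ j)^-1 :> R).
    by rewrite -powR_inv1 ?exprn_ge0 // -powRrM mulrC powRrM powRX // powR_inv1 // exprn_ge0 // ltW.
  rewrite [y ^+ _]exprS exprMn !exprVn le_eqVlt; apply/orP; left; apply/eqP; ring.
apply: le_trans (ler_sum _ (fun j _ => hj j)) _.
rewrite -mulr_sumr.
apply: le_trans (ler_wpM2l _ (sum_geom_le _ r01)) _.
  by rewrite !mulr_ge0 ?powR_ge0 ?exprn_ge0 ?(ltW y0) ?(ltW c0).
by rewrite le_eqVlt; apply/orP; left; apply/eqP; ring.
Qed.

(** Choose p' strictly between q and p and write d^p = d^p' d^a with a = p - p'. For d <= delta n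
    the second factor is at most (delta n)^a, while the first sums to at most C n^p'; [delta] is
    chosen so that C delta^a = eps. *)
Lemma low_degree_power_sum (k : nat) (p : R) : (1 < k)%N -> k%:R / (k%:R - 1) < p ->
  forall eps : R, 0 < eps -> exists2 delta : R, 0 < delta & forall G : sgraph,
    free (cycle_graph (2 * k)) G ->
    \sum_(v : G | (deg v)%:R <= delta * #|{: G}|%:R) (deg v)%:R `^ p <= eps * #|{: G}|%:R `^ p.
Proof.
move=> k1 hp eps eps0.
set q : R := k%:R / (k%:R - 1) in hp.
pose p' := (p + q) / 2.
have hp' : q < p' by rewrite /p'; lra.
have p1' : 1 < p' := exponent_gt1 k1 hp'.
have [C C0 hC] := e_p_le k1 hp'.
pose a := p - p'; have a0 : 0 < a by rewrite /a /p'; lra.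
exists ((eps / C) `^ a^-1); first by rewrite powR_gt0 // divr_gt0.
set delta := _ `^ _.
have da : delta `^ a = eps / C.
  by rewrite /delta -powRrM mulVf ?gt_eqF // powRr1 // divr_ge0 // ltW.
move=> G Gfree; set n := #|{: G}|.
have pE : p = p' + a by rewrite /a; ring.
have pa (x : R) : x `^ p = x `^ p' * x `^ a.
  have [->|x0] := eqVneq x 0.
    by rewrite !powR0 ?mul0r // gt_eqF //; lra.
  by rewrite pE powRD // x0 implybT.
have -> : eps * n%:R `^ p = (C * n%:R `^ p') * (delta * n%:R) `^ a.
  rewrite pa powRM ?ler0n ?powR_ge0 // da; field; exact: lt0r_neq0.
apply: le_trans (ler_wpM2r (powR_ge0 _ _) (hC _ Gfree)).
rewrite /e_p mulr_suml [leRHS](bigID (fun v : G => (deg v)%:R <= delta * n%:R)) /=.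
rewrite -[leLHS]addr0 lerD //; last by apply: sumr_ge0 => v _; rewrite mulr_ge0 ?powR_ge0.
apply: ler_sum => v hv; rewrite pa ler_wpM2l ?powR_ge0 //.
by rewrite ge0_ler_powR ?nnegrE ?(ltW a0) ?mulr_ge0 ?powR_ge0.
Qed.

End Powers.

(** * Common neighbours of k - 1 vertices *)

Fixpoint interleave (T : Type) (s t : seq T) : seq T :=
  match s, t with
  | x :: s', y :: t' => x :: y :: interleave s' t'
  | _, _ => [::]
  end.

Lemma interleave_perm (T : eqType) (s t : seq T) :
  size s = size t -> perm_eq (interleave s t) (s ++ t).
Proof.
elim: s t => [|x s IHs] [|y t] //= [st].
by rewrite perm_cons perm_sym -cat1s perm_catCA perm_cons perm_sym; exact: IHs.
Qed.

Lemma size_interleave (T : eqType) (s t : seq T) :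
  size s = size t -> size (interleave s t) = (2 * size s)%N.
Proof.
by move=> st; rewrite (perm_size (interleave_perm st)) size_cat st addnn mul2n.
Qed.

Lemma exists_uniq_seq (T : finType) (X : {set T}) (avoid : seq T) m :
  (m + size avoid <= #|X|)%N ->
  exists l, [/\ uniq l, size l = m, {subset l <= X} & ~~ has (mem avoid) l].
Proof.
elim: m => [|m IHm] hm; first by exists [::].
have [|l [ul sl lX la]] := IHm; first by apply: leq_trans hm; rewrite leq_add2r.
have [|x xX] := @exists_notin_seq T X (l ++ avoid); first by rewrite size_cat sl.
rewrite mem_cat negb_or => /andP[xl xa].
exists (x :: l); split; rewrite /= ?xl ?sl //.
- by move=> y; rewrite inE => /orP[/eqP->|/lX].
- by rewrite negb_or la andbT.
Qed.

Section CommonNeighbours.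
Variables (G : sgraph) (k : nat).
Hypothesis Gfree : free (cycle_graph (2 * k)) G.
Implicit Types (S : {set G}).
Local Notation e := (@edge G).

Definition common_nbrs S : {set G} := [set x : G | [forall s in S, e s x]]%SET.

Lemma common_nbrsP S x s : x \in common_nbrs S -> s \in S -> e s x.
Proof. by rewrite inE => /forall_inP; exact. Qed.

Lemma common_nbrs_notin S x : x \in common_nbrs S -> x \notin S.
Proof. by move=> xQ; apply/negP => /(common_nbrsP xQ); rewrite edge_irrefl. Qed.

Lemma interleave_path S s0 (qs ss : seq G) :
  s0 \in S -> {subset qs <= common_nbrs S} -> {subset ss <= S} ->
  path.path e s0 (interleave qs ss) /\ last s0 (interleave qs ss) \in S.
Proof.
elim: qs s0 ss => [|q qs IHq] s0 [|s ss] //= s0S qQ sS.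
have qS : q \in common_nbrs S by apply: qQ; rewrite mem_head.
have ssS : s \in S by apply: sS; rewrite mem_head.
have [||h1 h2] := IHq s ss ssS.
- by move=> x xq; apply: qQ; rewrite inE xq orbT.
- by move=> x xq; apply: sS; rewrite inE xq orbT.
by rewrite (common_nbrsP qS) // edge_sym (common_nbrsP qS).
Qed.

(* The path [x :: w] closes up through [s :: ss], with fresh common neighbours of [S] between consecutive vertices. *)
Lemma close_through S (w : seq G) (x s : G) (ss : seq G) :
  {subset s :: ss <= S} -> x \in common_nbrs S ->
  path.path e x w -> last x w \in common_nbrs S -> uniq ((x :: w) ++ s :: ss) ->
  (size ss + (size w).+1 <= #|common_nbrs S|)%N ->
  (2 * size ss + (size w).+2)%N <> (2 * k)%N.
Proof.
move=> sS xQ xw lw uw big sz.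
have [qs [uq sq qQ qw]] := @exists_uniq_seq _ (common_nbrs S) (x :: w) (size ss) big.
have sS' : {subset ss <= S} by move=> y ys; rewrite sS // inE ys orbT.
have s0S : s \in S by rewrite sS // mem_head.
have [h1 h2] := interleave_path s0S qQ sS'.
have pI := interleave_perm sq.
have cyc_uniq : uniq (x :: w ++ s :: interleave qs ss).
  have -> : uniq (x :: w ++ s :: interleave qs ss) = uniq (((x :: w) ++ s :: ss) ++ qs).
    apply: perm_uniq; rewrite -catA -cat_cons perm_cat2l /= perm_cons.
    by rewrite (perm_trans pI) // perm_catC.
  rewrite cat_uniq uw uq andbT; apply/hasPn => q qqs; rewrite mem_cat negb_or.
  apply/andP; split; first exact: (hasPn qw).
  by apply: contra (common_nbrs_notin (qQ _ qqs)); exact: sS.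
apply: (free_no_cycle Gfree) cyc_uniq _ _.
  have ls : e (last x w) s by rewrite edge_sym; exact: common_nbrsP lw s0S.
  by rewrite /= rcons_cat cat_path xw /= ls rcons_path h1 (common_nbrsP xQ h2).
by rewrite /= size_cat /= size_interleave // sq -sz; move: (size w) (size ss); clear; lia.
Qed.

(** Otherwise there is a complete bipartite graph with [k] vertices on each side, which contains a
    2k-cycle. *)
Lemma common_nbrs_card S : (1 < k)%N -> #|S| = k -> (#|common_nbrs S| < k)%N.
Proof.
move=> k1 cS; rewrite ltnNge; apply/negP => big.
have [x xQ] : exists x, x \in common_nbrs S.
  by apply/set0Pn; rewrite -card_gt0 (leq_trans _ big) // ltnW.
case E : (enum S) => [|s ss]; first by move: cS; rewrite cardE E /= => k0; rewrite -k0 in k1.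
have szE : (size ss).+1 = k by rewrite -cS cardE E.
have sS y : (y \in s :: ss) = (y \in S) by rewrite -E mem_enum.
apply: (@close_through S [::] x s ss) => //.
- by move=> y; rewrite sS.
- rewrite cat_uniq -E enum_uniq andbT /=; apply/hasPn => y; rewrite mem_enum inE => yS.
  by apply: contraTneq yS => ->; exact: common_nbrs_notin.
- by rewrite addn1 szE.
- by rewrite -szE /= mulnS addnC.
Qed.

(** Two such neighbours give a path [q1], [x], [q2], which closes up through all k - 1 vertices of
    [S] and k - 2 further common neighbours, 2k vertices in all. *)
Lemma nbrs_common_nbrs S x : (1 < k)%N -> #|S| = k.-1 -> (k.+1 <= #|common_nbrs S|)%N ->
  x \notin S -> (#|nbrs_in e (common_nbrs S) x| <= 1)%N.
Proof.
move=> k1 cS big xS; rewrite leqNgt; apply/negP => /card_gt1P[q1 [q2]].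
rewrite !inE => -[/andP[/forall_inP q1Q xq1] /andP[/forall_inP q2Q xq2] q12].
have {}q1Q : q1 \in common_nbrs S by rewrite inE; apply/forall_inP.
have {}q2Q : q2 \in common_nbrs S by rewrite inE; apply/forall_inP.
case E : (enum S) => [|s ss].
  by move: cS; rewrite cardE E /= => k0; move: k1; rewrite -subn_gt0 subn1 -k0.
have szE : (size ss).+2 = k by rewrite -(ltn_predK k1) -cS cardE E.
have sS y : (y \in s :: ss) = (y \in S) by rewrite -E mem_enum.
apply: (@close_through S [:: x; q2] q1 s ss) => //.
- by move=> y; rewrite sS.
- by rewrite /= edge_sym xq1 xq2.
- have nx (y : G) : e x y -> y != x by apply: contraTneq => ->; rewrite edge_irrefl.
  rewrite cat_uniq -E enum_uniq andbT /= !inE (negbTE q12) (negbTE (nx _ xq1)) /=.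
  rewrite eq_sym (negbTE (nx _ xq2)) /= E.
  apply/hasPn => y; rewrite sS !inE => yS; apply/norP; split; last (apply/norP; split).
  - by apply: contraTneq yS => ->; exact: common_nbrs_notin.
  - by apply: contraTneq yS => ->.
  - by apply: contraTneq yS => ->; exact: common_nbrs_notin.
- by rewrite -szE /= addn3 in big *.
- by rewrite -szE /=; clear; lia.
Qed.

(** Two disjoint edges are linked by one vertex [s1] of [S]; the path on these five vertices closes
    up through the other k - 2 vertices of [S] and k - 3 common neighbours. *)
Lemma common_nbrs_edges_meet S a1 b1 a2 b2 :
  (2 < k)%N -> #|S| = k.-1 -> (k.+1 < #|common_nbrs S|)%N ->
  {subset [:: a1; b1; a2; b2] <= common_nbrs S} ->
  e a1 b1 -> e a2 b2 -> ~~ uniq [:: a1; b1; a2; b2].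
Proof.
move=> k2 cS big sub e1 e2; apply/negP => u4.
case E : (enum S) => [|s1 [|s2 ss]].
- by move: cS; rewrite cardE E /=; move: k2; clear; lia.
- by move: cS; rewrite cardE E /=; move: k2; clear; lia.
have szE : (size ss).+3 = k by move: cS; rewrite cardE E /=; move: k2; clear; lia.
have sS y : (y \in s1 :: s2 :: ss) = (y \in S) by rewrite -E mem_enum.
have s1S : s1 \in S by rewrite -sS mem_head.
have inS y : y \in common_nbrs S -> y \in S = false by move/common_nbrs_notin/negbTE.
apply: (@close_through S [:: b1; s1; a2; b2] a1 s2 ss) => //.
- by move=> y ys; rewrite -sS inE ys orbT.
- by apply: sub; rewrite mem_head.
- rewrite /= e1 e2 edge_sym !(common_nbrsP _ s1S) //; apply: sub; rewrite !inE eqxx ?orbT //.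
- by apply: sub; rewrite !inE eqxx !orbT.
- have -> : uniq ([:: a1; b1; s1; a2; b2] ++ s2 :: ss) = uniq ([:: a1; b1; a2; b2] ++ enum S).
    rewrite E; apply: perm_uniq; rewrite /= !perm_cons.
    exact/permPl/(perm_catCA [:: s1] [:: a2; b2] (s2 :: ss)).
  rewrite cat_uniq u4 enum_uniq andbT; apply/hasPn => y; rewrite mem_enum => yS.
  by apply: contraL yS => /sub/inS ->.
- by move: big; rewrite -szE /= !addnS addn0.
- by rewrite -szE /=; clear; lia.
Qed.

(** Any two edges among the common neighbours meet, and a shared vertex has only one neighbour
    there, so the edges coincide: [P] is the set of ends of the only possible edge. *)
Lemma common_nbrs_edges S :
  (2 < k)%N -> #|S| = k.-1 -> (k.+1 < #|common_nbrs S|)%N ->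
  exists2 P : {set G}, (#|P| <= 2)%N /\ P \subset common_nbrs S &
    forall x y, x \in common_nbrs S -> y \in common_nbrs S -> e x y -> x \in P /\ y \in P.
Proof.
move=> k2 cS big; have k1 := ltnW k2.
have [/existsP[a /existsP[b /and3P[aQ bQ ab]]]|none] :=
  boolP [exists a, [exists b, [&& a \in common_nbrs S, b \in common_nbrs S & e a b]]]; last first.
  exists (finset.set0); first by rewrite cards0 finset.sub0set.
  move=> x y xQ yQ xy; exfalso; move/existsP: none; apply; exists x; apply/existsP; exists y.
  by rewrite xQ yQ.
have one x y z : x \in common_nbrs S -> y \in common_nbrs S -> z \in common_nbrs S ->
    e x y -> e x z -> y = z.
  move=> xQ yQ zQ xy xz; apply/eqP; rewrite -[_ == _]negbK; apply/negP => yz.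
  have := nbrs_common_nbrs k1 cS (ltnW big) (common_nbrs_notin xQ).
  rewrite leqNgt => /negP; apply; apply/card_gt1P; exists y, z.
  split=> //; first by rewrite [_ \in nbrs_in _ _ _]inE yQ.
  by rewrite [_ \in nbrs_in _ _ _]inE zQ.
exists [set a; b]%SET.
  split; first by rewrite cards2; case: (a != b).
  by apply/fintype.subsetP => x; rewrite finset.in_set2 => /orP[]/eqP->.
move=> x y xQ yQ xy.
have yx : e y x by rewrite edge_sym.
have ba : e b a by rewrite edge_sym.
have := @common_nbrs_edges_meet S a b x y k2 cS big _ ab xy.
have H : {subset [:: a; b; x; y] <= common_nbrs S}.
  by move=> z; rewrite mem_seq4 => /or4P[]/eqP->.
move=> /(_ H) /=; rewrite !inE.
have nab : a != b by apply: contraTneq ab => ->; rewrite edge_irrefl.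
have nxy : x != y by apply: contraTneq xy => ->; rewrite edge_irrefl.
rewrite (negbTE nab) (negbTE nxy) /= !andbT negb_and !negbK => /orP[/orP[]|/orP[]]/eqP E; subst.
- by rewrite (one _ _ _ aQ bQ yQ ab xy) !eqxx !orbT.
- by rewrite (one _ _ _ aQ bQ xQ ab yx) !eqxx !orbT.
- by rewrite (one _ _ _ bQ aQ yQ ba xy) !eqxx !orbT.
- by rewrite (one _ _ _ bQ aQ xQ ba yx) !eqxx !orbT.
Qed.

End CommonNeighbours.

(** * The extremal graphs *)

Lemma card_join (G H : sgraph) : #|{: join G H}| = (#|{: G}| + #|{: H}|)%N.
Proof. exact: card_sum. Qed.

Lemma deg_sum (G : sgraph) (v : G) : deg v = (\sum_(w : G) edge v w)%N.
Proof.
rewrite /deg -sum1_card big_mkcond; apply: eq_bigr => w _; rewrite inE.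
by case: (edge v w).
Qed.

Lemma deg_inl (G H : sgraph) (a : G) :
  @deg (join G H) (inl a) = (deg a + #|{: H}|)%N.
Proof.
rewrite !deg_sum big_sumType /=; congr (_ + _)%N.
by rewrite sum1_card.
Qed.

Lemma deg_inr (G H : sgraph) (b : H) :
  @deg (join G H) (inr b) = (#|{: G}| + deg b)%N.
Proof.
rewrite !deg_sum big_sumType /=; congr (_ + _)%N.
by rewrite sum1_card.
Qed.

Lemma deg_complete s (a : complete s) : deg a = s.-1.
Proof.
rewrite /deg -[in RHS](card_ord s) -(cardC1 a); apply: eq_card => b.
by rewrite !inE eq_sym.
Qed.

Lemma e_p_join_complete (R : realType) (p : R) s (H : sgraph) :
  e_p p (join (complete s) H) =
    s%:R * (s + #|{: H}|).-1%:R `^ p + \sum_(b : H) (s + deg b)%:R `^ p.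
Proof.
rewrite /e_p big_sumType /=; congr (_ + _).
  case: s => [|s]; first by rewrite big_ord0 mul0r.
  rewrite -[in RHS](card_ord s.+1) mulr_natl -sumr_const; apply: eq_bigr => a _.
  by rewrite deg_inl deg_complete card_ord.
by apply: eq_bigr => b _; rewrite deg_inr card_ord.
Qed.

(** One vertex outside the clique is dropped so that the bound has the same shape as the one for
    [Lgraph1], where the last vertex may be unmatched; [common_nbrs_compl] then serves both
    graphs. *)
Lemma Egraph_e_p_ge (R : realType) (p : R) n s : (0 <= p) -> (s <= n)%N ->
  s%:R * n.-1%:R `^ p + (n - s).-1%:R * s%:R `^ p <= e_p p (Egraph n s).
Proof.
move=> p0 sn; rewrite e_p_join_complete card_ord subnKC // lerD2l.
apply: le_trans (_ : \sum_(b : one_edge (n - s)) s%:R `^ p <= _).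
  rewrite sumr_const card_ord -[leRHS]mulr_natl ler_wpM2r ?powR_ge0 // ler_nat.
  exact: leq_pred.
apply: ler_sum => b _; apply: ge0_ler_powR; rewrite ?nnegrE ?ler0n //.
by rewrite ler_nat leq_addr.
Qed.

Lemma matching_mate m (b : matching m) : (b.+1 < m)%N -> (0 < deg b)%N.
Proof.
move=> bm; rewrite /deg card_gt0.
have [ob|eb] := boolP (odd b).
  have b'm : (b.-1 < m)%N by move: bm; clear; lia.
  apply/set0Pn; exists (Ordinal b'm); rewrite inE /edge /= -val_eqE /=.
  by move: ob; case: (nat_of_ord b) => //= c; rewrite ?negbK => oc; apply/andP; split; lia.
apply/set0Pn; exists (Ordinal bm); rewrite inE /edge /= -val_eqE /=.
by move: eb; clear; lia.
Qed.

Lemma Lgraph1_e_p_ge (R : realType) (p : R) n : (0 <= p) -> (1 <= n)%N ->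
  n.-1%:R `^ p + n.-2%:R * 2%:R `^ p <= e_p p (Lgraph1 n 1).
Proof.
move=> p0 n1; rewrite e_p_join_complete card_ord subnKC // mul1r lerD2l.
rewrite subn1; case: (n.-1) => [|m /=]; first by rewrite mul0r sumr_ge0 // => b _; rewrite powR_ge0.
rewrite big_ord_recr /= -[leLHS]addr0 lerD ?powR_ge0 //.
rewrite -[in leLHS](card_ord m) mulr_natl -sumr_const; apply: ler_sum => b _.
apply: ge0_ler_powR; rewrite ?nnegrE ?ler0n // ler_nat ltnS.
by apply: (@matching_mate m.+1 (widen_ord (leqnSn m) b)); rewrite /= ltnS.
Qed.

(** * Cycle-freeness of the extremal graphs *)

Section JoinFree.
Variables (N s : nat) (H : sgraph) (f : 'I_N -> join (complete s) H).
Hypothesis f_inj : injective f.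
Hypothesis f_hom : forall i, edge (f i) (f (ordS i)).

Let left : {set 'I_N} := [set i | if f i is inl _ then true else false]%SET.

Lemma card_left : (#|left| <= s)%N.
Proof.
rewrite -[X in (_ <= X)%N](card_ord s) -(card_imset _ f_inj).
rewrite -[X in (_ <= X)%N](card_imset _ (@inl_inj 'I_s H)).
apply: subset_leq_card; apply/fintype.subsetP => x /imsetP[i]; rewrite inE.
by case E : (f i) => [a|//] _ ->; rewrite imset_f.
Qed.

Lemma right_edge i : i \notin left -> ordS i \notin left ->
  exists a b, [/\ f i = inr a, f (ordS i) = inr b & edge a b].
Proof.
rewrite !inE; have := f_hom i.
by case: (f i) => // a; case: (f (ordS i)) => // b ab _ _; exists a, b.
Qed.

(** Each of the at most [s] cycle vertices in the clique lies on two cycle edges; all other cycle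
    edges are mapped into [H]. *)
Lemma card_right_edges : (N <= 2 * s + #|[set i | (i \notin left) && (ordS i \notin left)]%SET|)%N.
Proof.
have H1 : (#|~: [set i | (i \notin left) && (ordS i \notin left)]%SET| <= 2 * s)%N.
  have -> : ~: [set i | (i \notin left) && (ordS i \notin left)]%SET =
      (left :|: (@ordS N @^-1: left))%SET.
    by apply/setP => i; rewrite !inE negb_and !negbK.
  apply: leq_trans (leq_card_setU _ _) _; rewrite mul2n -addnn leq_add ?card_left //.
  rewrite -(card_imset _ (@ordS_inj N)); apply: leq_trans card_left.
  by apply: subset_leq_card; apply/fintype.subsetP => x /imsetP[i]; rewrite finset.inE => iL ->.
have := cardsC [set i | (i \notin left) && (ordS i \notin left)]%SET.
rewrite card_ord => E; apply: leq_trans (eq_leq (esym E)) _.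
by rewrite addnC leq_add2r.
Qed.

End JoinFree.

Lemma cycle_edge N (i : 'I_N) : (1 < N)%N -> @edge (cycle_graph N) i (ordS i).
Proof.
move=> N1; rewrite /edge /= eqxx andbT -val_eqE /=.
have [iN|iN] := ltnP i.+1 N; first by rewrite modn_small //; clear; lia.
have E : i.+1 = N by apply/eqP; rewrite eqn_leq iN ltn_ord.
have -> : (i.+1 %% N = 0)%N by rewrite E modnn.
by move: N1 E; clear; lia.
Qed.

(** At least 2k - 2(k - 1) = 2 cycle edges would lie in the one-edge graph. Traversing its only edge
    twice forces [ordS (ordS i) = i], impossible for length above 2. *)
Lemma Egraph_free n k : (1 < k)%N -> free (cycle_graph (2 * k)) (Egraph n k.-1).
Proof.
move=> k1 [f f_inj f_hom].
have N2 : (2 < 2 * k)%N by move: k1; clear; lia.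
have hom i : edge (f i) (f (ordS i)) by apply: f_hom; apply: cycle_edge; exact: ltnW.
have := card_right_edges f_inj.
set J := [set i | _]%SET => cJ.
have /card_gt1P[i [j [iJ jJ ij]]] : (1 < #|J|)%N by move: cJ k1; clear; lia.
have edgeJ l : l \in J -> exists a b : 'I_(n - k.-1),
    [/\ f l = inr a, f (ordS l) = inr b & [&& a != b, (a < 2)%N & (b < 2)%N]].
  by rewrite inE => /andP[h1 h2]; exact: (right_edge hom).
have [a [b [fa fb /and3P[ab a2 b2]]]] := edgeJ i iJ.
have [c [d [fc fd /and3P[cd c2 d2]]]] := edgeJ j jJ.
have ac : a != c by apply: contraNneq ij => E; apply/eqP/f_inj; rewrite fa fc E.
have bc : b = c.
  apply/val_inj; move: ab ac a2 b2 c2; rewrite -!val_eqE /=; move: (val a) (val b) (val c); clear; lia.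
have ad : a = d.
  apply/val_inj; move: cd ac a2 d2 c2; rewrite -!val_eqE /=; move: (val a) (val d) (val c); clear; lia.
have E1 : ordS i = j by apply: f_inj; rewrite fb fc bc.
have E2 : ordS j = i by apply: f_inj; rewrite fd fa ad.
move/(congr1 val): E2; rewrite -E1 /= => E2.
have iN := ltn_ord i.
have [iN1|iN1] := ltnP i.+1 (2 * k)%N; last first.
  have EN : i.+1 = (2 * k)%N by apply/eqP; rewrite eqn_leq iN iN1.
  have Z : (i.+1 %% (2 * k) = 0)%N by rewrite EN modnn.
  by move: E2; rewrite Z modn_small ?(ltnW N2) //; move: N2 EN; clear; lia.
move: E2; rewrite (modn_small iN1).
have [iN2|iN2] := ltnP i.+2 (2 * k)%N; first by rewrite modn_small //; clear; lia.
have -> : i.+2 = (2 * k)%N by apply/eqP; rewrite eqn_leq iN1 iN2.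
by rewrite modnn => i0; move: iN2 N2; rewrite -i0; clear; lia.
Qed.

(** At most one cycle vertex is the centre, so the three that follow it would form a path with two
    edges in the matching. *)
Lemma Lgraph1_free n : free (cycle_graph 4) (Lgraph1 n 1).
Proof.
move=> [f f_inj f_hom].
have hom i : edge (f i) (f (ordS i)) by apply: f_hom; exact: cycle_edge.
have := card_left f_inj; set L := [set i | _]%SET => cL.
have [i [i0 i1 i2]] : exists i : 'I_4, [/\ i \notin L, ordS i \notin L & ordS (ordS i) \notin L].
  have [->|[m mL]] := set_0Vmem L; first by exists ord0; rewrite !inE.
  have H j : j \in L -> j = m.
    by move=> jL; apply/eqP; move: cL; rewrite leqNgt; apply: contraNT => jm; apply/card_gt1P; exists j, m.
  exists (ordS m); split; apply/negP => /H /(congr1 val);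
    by case: m {mL H} => [[|[|[|[|]]]]].
have [a [b [fa fb /andP[ab /eqP ab2]]]] := right_edge hom i0 i1.
have [b' [c [fb' fc /andP[bc /eqP bc2]]]] := right_edge hom i1 i2.
have E : b' = b by move: fb'; rewrite fb => -[].
rewrite {}E in bc bc2.
have ac : a != c.
  apply/eqP => E; have : i = ordS (ordS i) by apply: f_inj; rewrite fa fc E.
  by move/(congr1 val); case: (i) => [[|[|[|[|]]]]].
move: ab bc ac ab2 bc2; rewrite -!val_eqE /=; move: (val a) (val b) (val c); clear; lia.
Qed.

(** Through [g], the graph [G] is a spanning subgraph of [H], so its degrees are at most those of
    [H]. As x^p is strictly increasing, the inequality on [e_p] forces equal degrees, hence equal
    neighbourhoods. *)
Lemma hom_isomorphic (R : realType) (p : R) (G H : sgraph) (g : H -> G) :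
  0 < p -> injective g -> #|{: G}| = #|{: H}| ->
  (forall a b, edge (g a) (g b) -> edge a b) -> e_p p H <= e_p p G ->
  isomorphic G H.
Proof.
move=> p0 g_inj cGH g_hom le.
have g_bij : bijective g by apply: inj_card_bij => //; rewrite cGH.
have [f gK fK] := g_bij.
have subN a : ([set w | edge (g a) w] \subset g @: [set w | edge a w])%SET.
  apply/fintype.subsetP => w; rewrite inE -(fK w) => /g_hom aw.
  by rewrite mem_imset // inE.
have degle a : (deg (g a) <= deg a)%N.
  by rewrite /deg -[X in (_ <= X)%N](card_imset _ g_inj) subset_leq_card.
have EG : e_p p G = \sum_a (deg (g a))%:R `^ p.
  by rewrite /e_p (reindex g) //; apply: onW_bij.
have powle a : (deg (g a))%:R `^ p <= (deg a)%:R `^ p.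
  by rewrite ge0_ler_powR ?nnegrE ?ler0n ?ler_nat ?degle // ltW.
have degeq a : deg (g a) = deg a.
  apply/eqP; move: le; rewrite EG /e_p -subr_ge0 -sumrB => H0.
  have : \sum_(i : H) ((deg i)%:R `^ p - (deg (g i))%:R `^ p) == 0.
    rewrite eq_le -oppr_ge0 -sumrN; under eq_bigr do rewrite opprB.
    by rewrite H0 sumr_ge0 // => i _; rewrite subr_ge0.
  rewrite psumr_eq0; last by move=> i _; rewrite subr_ge0.
  move/allP/(_ a); rewrite mem_index_enum => /(_ isT) /=.
  rewrite subr_eq0 => /eqP/(powR_injective p0) E.
  by rewrite -(eqr_nat R) E ?nnegrE ?ler0n.
exists f; first by exists g.
move=> x y; rewrite -{2}(fK x) -{2}(fK y); move: (f x) (f y) => a b.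
apply/idP/idP => [ab|/g_hom//].
have /eqP E : ([set w | edge (g a) w] == g @: [set w | edge a w])%SET.
  by rewrite eqEcard subN card_imset // -![#|[set w | _]|]/(deg _) degeq leqnn.
have : g b \in (g @: [set w | edge a w])%SET by rewrite imset_f // inE.
by rewrite -E inE.
Qed.

(** Only the edges outside [S] have to be controlled: those inside [S] map to the complete graph
    whatever they are, and [hom_isomorphic] then shows that all of them are present. *)
Lemma join_isomorphic (R : realType) (p : R) (G H : sgraph) (S : {set G}) (u : H -> G) :
  0 < p -> common_nbrs S = (~: S)%SET -> #|{: G}| = (#|S| + #|{: H}|)%N ->
  injective u -> (forall b, u b \notin S) ->
  (forall b c, edge (u b) (u c) -> edge b c) ->
  e_p p (join (complete #|S|) H) <= e_p p G -> isomorphic G (join (complete #|S|) H).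
Proof.
move=> p0 SQ cG u_inj uS u_hom.
pose g (w : join (complete #|S|) H) : G :=
  match w with inl i => enum_val i | inr b => u b end.
apply: (@hom_isomorphic R p _ _ g) => //.
- move=> [i|b] [j|c] /=.
  + by move/enum_val_inj ->.
  + by move=> E; move: (uS c); rewrite -E enum_valP.
  + by move=> E; move: (uS b); rewrite E enum_valP.
  + by move/u_inj ->.
- by rewrite card_join card_ord.
- move=> [i|b] [j|c] //=; last exact: u_hom.
  by apply: contraTneq => ->; rewrite edge_irrefl.
Qed.

Lemma isomorphic_Egraph (R : realType) (p : R) k (G : sgraph) (S : {set G}) :
  0 < p -> (2 < k)%N -> free (cycle_graph (2 * k)) G -> #|S| = k.-1 ->
  common_nbrs S = (~: S)%SET -> (k.+1 < #|common_nbrs S|)%N ->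
  e_p p (Egraph #|{: G}| k.-1) <= e_p p G -> isomorphic G (Egraph #|{: G}| k.-1).
Proof.
move=> p0 k2 Gfree cS SQ big.
have [P [cP PQ] hP] := common_nbrs_edges Gfree k2 cS big.
have [x0 _] : exists x, x \in common_nbrs S by apply/set0Pn; rewrite -card_gt0; apply: leq_ltn_trans big.
(* Listing [P] first puts the ends of a possible edge at positions 0 and 1, as in [one_edge]. *)
pose l := enum P ++ enum (common_nbrs S :\: P)%SET.
have ul : uniq l.
  rewrite cat_uniq !enum_uniq andbT; apply/hasPn => x.
  by rewrite mem_enum finset.in_setD /= mem_enum => /andP[].
have lQ x : (x \in l) = (x \in common_nbrs S).
  rewrite mem_cat !mem_enum finset.in_setD.
  by have [/(fintype.subsetP PQ)->|] := boolP (x \in P).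
have sl : size l = (#|{: G}| - #|S|)%N.
  have -> : size l = #|common_nbrs S| by rewrite cardE; apply/perm_size/uniq_perm; rewrite ?enum_uniq // => x; rewrite lQ mem_enum.
  by rewrite SQ cardsCs finset.setCK.
rewrite /Egraph -cS.
pose u (i : one_edge (#|{: G}| - #|S|)) : G := nth x0 l i.
have ilt (i : one_edge (#|{: G}| - #|S|)) : (i < size l)%N by rewrite sl ltn_ord.
have uQ i : u i \in common_nbrs S by rewrite -lQ mem_nth.
apply: (@join_isomorphic R p G _ S u) => //.
- by rewrite card_ord subnKC // max_card.
- by move=> i j /eqP; rewrite nth_uniq ?ilt // => /eqP/val_inj.
- by move=> i; exact: common_nbrs_notin.
move=> i j ij.
have [iP jP] := hP _ _ (uQ i) (uQ j) ij.
have P2 (m : one_edge (#|{: G}| - #|S|)) : u m \in P -> (m < 2)%N.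
  move=> mP; apply: leq_trans cP; rewrite ltnNge; apply/negP => mge.
  have : u m \in enum (common_nbrs S :\: P)%SET.
    rewrite /u nth_cat -cardE ltnNge mge /=; apply: mem_nth.
    by have := ilt m; rewrite size_cat -cardE ltn_subLR.
  by rewrite mem_enum finset.in_setD mP.
rewrite /edge /= !P2 // !andbT.
by apply: contraTneq ij => ->; rewrite edge_irrefl.
Qed.

(** Take out an edge, list the rest by induction and put the two ends in front: no other edge meets
    them, and shifting by two positions respects the pairing by halves. If no edge is left, any
    order works. *)
Lemma matching_seq (G : sgraph) (X : {set G}) :
  {in X, forall x, #|nbrs_in (@edge G) X x| <= 1}%N ->
  exists l, [/\ uniq l, l =i X & forall x0 i j, (i < size l)%N -> (j < size l)%N ->
    edge (nth x0 l i) (nth x0 l j) -> i./2 = j./2].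
Proof.
move: {2}#|_| (leqnn #|X|) => m; elim: m X => [|m IHm] X.
  rewrite leqn0 cards_eq0 => /eqP -> _; exists [::]; split=> // x.
  by rewrite !inE.
move=> cX X1.
have [/existsP[x /existsP[y /and3P[xX yX xy]]]|none] :=
  boolP [exists x, [exists y, [&& x \in X, y \in X & edge x y]]]; last first.
  exists (enum X); split; [exact: enum_uniq | by move=> x; rewrite mem_enum |].
  move=> x0 i j iX jX ij; exfalso; move/existsP: none; apply.
  exists (nth x0 (enum X) i); apply/existsP; exists (nth x0 (enum X) j).
  have mX l : (l < size (enum X))%N -> nth x0 (enum X) l \in X by move=> lX; rewrite -mem_enum mem_nth.
  by rewrite ij !mX.
have one a b c : a \in X -> b \in X -> c \in X -> edge a b -> edge a c -> b = c.
  move=> aX bX cX' ab ac; apply/eqP; apply: contraTT (X1 _ aX) => bc.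
  by rewrite -ltnNge; apply/card_gt1P; exists b, c; rewrite !inE bX cX' ab ac.
have nxy : x != y by apply: contraTneq xy => ->; rewrite edge_irrefl.
pose X' := (X :\ x :\ y)%SET.
have XX' : X' \subset X by apply/fintype.subsetP => z; rewrite !finset.inE => /and3P[].
have [||l [ul lX' hl]] := IHm X'.
- move: cX; rewrite (cardsD1 x) xX (cardsD1 y (X :\ x)%SET) !inE eq_sym nxy yX.
  by rewrite -/X' !add1n ltnS => /ltnW.
- move=> z zX'; apply: leq_trans (X1 _ (fintype.subsetP XX' _ zX')).
  apply: subset_leq_card; apply/fintype.subsetP => w; rewrite !finset.inE.
  by case/andP=> /and3P[_ _ ->] ->.
exists [:: x, y & l]; split.
- by rewrite /= !inE negb_or nxy !lX' !inE !eqxx ul /= andbF.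
- move=> z; rewrite !inE lX' !inE; case: eqP => [->|_]; first by rewrite xX.
  by case: eqP => [->|_]; first by rewrite yX.
move=> x0; have cross z i : (z == x) || (z == y) -> (i < size l)%N -> ~~ edge z (nth x0 l i).
  move=> zxy il; have /[!lX'] : nth x0 l i \in l by rewrite mem_nth.
  rewrite !inE => /and3P[ny nx wX]; apply/negP => zw.
  case/orP: zxy => /eqP zE; rewrite zE in zw.
    by move: ny; rewrite (one _ _ _ xX yX wX xy zw) eqxx.
  by move: nx; rewrite (one _ _ _ yX xX wX _ zw) ?eqxx // edge_sym.
move=> [|[|i]] [|[|j]] //= iX jX.
- by move=> xw; have := cross x j; rewrite eqxx xw => /(_ isT jX).
- by move=> xw; have := cross y j; rewrite eqxx orbT xw => /(_ isT jX).
- by rewrite edge_sym => xw; have := cross x i; rewrite eqxx xw => /(_ isT iX).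
- by rewrite edge_sym => xw; have := cross y i; rewrite eqxx orbT xw => /(_ isT iX).
- by move/hl => -> //.
Qed.

Lemma isomorphic_Lgraph1 (R : realType) (p : R) (G : sgraph) (S : {set G}) :
  0 < p -> free (cycle_graph 4) G -> #|S| = 1%N ->
  common_nbrs S = (~: S)%SET -> (2 < #|common_nbrs S|)%N ->
  e_p p (Lgraph1 #|{: G}| 1) <= e_p p G -> isomorphic G (Lgraph1 #|{: G}| 1).
Proof.
move=> p0 Gfree cS SQ big.
have [|l [ul lQ hl]] := @matching_seq G (common_nbrs S).
  by move=> x xQ; apply: (@nbrs_common_nbrs G 2 Gfree S) => //; exact: common_nbrs_notin.
have [x0 _] : exists x, x \in common_nbrs S by apply/set0Pn; rewrite -card_gt0; apply: leq_ltn_trans big.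
have sl : size l = (#|{: G}| - #|S|)%N.
  have -> : size l = #|common_nbrs S| by rewrite cardE; apply/perm_size/uniq_perm; rewrite ?enum_uniq // => x; rewrite lQ mem_enum.
  by rewrite SQ cardsCs finset.setCK.
rewrite /Lgraph1; move: sl; rewrite -[in complete 1]cS -[in (_ - 1)%N]cS => sl.
pose u (i : matching (#|{: G}| - #|S|)) : G := nth x0 l i.
have ilt (i : matching (#|{: G}| - #|S|)) : (i < size l)%N by rewrite sl ltn_ord.
have uQ i : u i \in common_nbrs S by rewrite -lQ mem_nth.
apply: (@join_isomorphic R p G _ S u) => //.
- by rewrite card_ord subnKC // max_card.
- by move=> i j /eqP; rewrite nth_uniq ?ilt // => /eqP/val_inj.
- by move=> i; exact: common_nbrs_notin.
move=> i j ij; rewrite /edge /= (hl x0 i j) ?ilt // eqxx andbT.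
by apply: contraTneq ij => ->; rewrite edge_irrefl.
Qed.

(** * Vertices of nearly full degree *)

Lemma exists_subset_card (T : finType) (X : {set T}) m :
  (m <= #|X|)%N -> exists2 Y : {set T}, Y \subset X & #|Y| = m.
Proof.
move=> mX; have [|l [ul sl lX _]] := @exists_uniq_seq T X [::] m; first by rewrite addn0.
exists [set x in l]%SET; first by apply/fintype.subsetP => x; rewrite inE => /lX.
by rewrite cardsE -sl; apply/card_uniqP.
Qed.

(** Count from the other side: a vertex with at least [k] neighbours in [W] is a common neighbour of
    some k-subset of [W]. There are at most [2 ^ #|W|] such subsets, each with fewer than [k] common
    neighbours, and each such vertex contributes at most [#|W|]. *)
Lemma sum_deg_le (G : sgraph) k (W : {set G}) :
  (1 < k)%N -> free (cycle_graph (2 * k)) G ->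
  (\sum_(w in W) deg w <= k.-1 * #|{: G}| + #|W| * (2 ^ #|W| * k))%N.
Proof.
move=> k1 Gfree; under eq_bigr do rewrite degE.
rewrite sum_nbrs_in_sym; last exact: edge_sym.
pose F (v : G) := (\sum_(T : {set G} | (T \subset W) && (#|T| == k)) (v \in common_nbrs T))%N.
have hF v : (#|nbrs_in (@edge G) W v| <= k.-1 + #|W| * F v)%N.
  have [le|gt] := leqP #|nbrs_in (@edge G) W v| k.-1.
    by apply: leq_trans le _; exact: leq_addr.
  have [|T TN cT] := @exists_subset_card _ (nbrs_in (@edge G) W v) k.
    by rewrite -(ltn_predK k1).
  have TW : T \subset W.
    by apply: fintype.subset_trans TN _; apply/fintype.subsetP => x; rewrite inE => /andP[].
  have vT : v \in common_nbrs T.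
    rewrite inE; apply/forall_inP => x /(fintype.subsetP TN); rewrite inE => /andP[_].
    by rewrite edge_sym.
  have F1 : (0 < F v)%N by rewrite /F (bigD1 T) ?TW ?cT ?eqxx //= vT.
  apply: leq_trans (leq_addl _ _); apply: leq_trans (leq_pmulr _ F1).
  by apply: subset_leq_card; apply/fintype.subsetP => x; rewrite inE => /andP[].
have -> : (\sum_(y in [set: G]%SET) #|nbrs_in (@edge G) W y| = \sum_(y : G) #|nbrs_in (@edge G) W y|)%N.
  by apply: eq_bigl => x; rewrite inE.
apply: (@leq_trans (\sum_(v : G) (k.-1 + #|W| * F v))%N); first by apply: leq_sum => v _; exact: hF.
rewrite big_split /= sum_nat_const mulnC leq_add2l -big_distrr /= leq_mul2l; apply/orP; right.
rewrite /F exchange_big /= -card_powerset -sum_nat_const.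
rewrite [X in (_ <= X)%N](bigID (fun T : {set G} => #|T| == k)) /=; apply: leq_trans (leq_addr _ _).
rewrite [X in (_ <= X)%N](eq_bigl (fun T : {set G} => (T \subset W) && (#|T| == k))); last first.
  by move=> T; rewrite powersetE.
apply: leq_sum => T /andP[_ /eqP cT].
apply: leq_trans (ltnW (common_nbrs_card Gfree k1 cT)).
by rewrite -sum1_card [X in (_ <= X)%N]big_mkcond; apply: leq_sum => v _; case: (v \in _).
Qed.

Section Heavy.
Variable R : realType.

Lemma bernoulli_ge (x : R) m : 0 <= x <= 1 -> 1 - m%:R * x <= (1 - x) ^+ m.
Proof.
move=> /andP[x0 x1]; elim: m => [|m IHm]; first by rewrite mul0r subr0 expr0.
rewrite exprS; apply: le_trans (ler_wpM2l _ IHm); last lra.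
have H : 0 <= m%:R * (x * x) by rewrite !mulr_ge0.
rewrite -natr1 -subr_ge0; apply: le_trans H _; rewrite le_eqVlt; apply/orP; left; apply/eqP; ring.
Qed.

(** Let y = deg / n on the bounded set [W] of vertices of degree above delta n. The sum of y is at
    most k - 1 + eps, that of y^p at least k - 1 - 2 eps. Since y - y^p >= kap y whenever y < 1 -
    eta, such vertices have total y at most 3 eps / kap, so the others number more than k - 2. *)
Lemma heavy_vertices (k : nat) (p eta : R) : (1 < k)%N -> k%:R / (k%:R - 1) < p ->
  0 < eta < 1 -> exists n0 : nat, forall G : sgraph,
    free (cycle_graph (2 * k)) G -> (n0 <= #|{: G}|)%N ->
    k.-1%:R * #|{: G}|.-1%:R `^ p <= e_p p G ->
    exists2 S : {set G}, #|S| = k.-1 &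
      {in S, forall s, (1 - eta) * #|{: G}|%:R <= (deg s)%:R}.
Proof.
move=> k1 hp /andP[eta0 eta1].
have p1 := exponent_gt1 k1 hp.
have p0 : 0 < p by lra.
pose kap := 1 - (1 - eta) `^ (p - 1).
have kap0 : 0 < kap.
  rewrite subr_gt0; have E1 : 1 `^ (p - 1) = 1 :> R by rewrite powR1.
  by rewrite -[ltRHS]E1 gt0_ltr_powR ?nnegrE //; lra.
have [eps [eps0 heps]] : exists eps : R, 0 < eps /\ eps * 2 + eps * 3 / kap < 1.
  exists (2 * (2 + 3 / kap))^-1; split.
    by rewrite invr_gt0 mulr_gt0 // addr_gt0 // divr_gt0.
  have y0 : 0 < 2 + 3 / kap by rewrite addr_gt0 // divr_gt0.
  set e := _^-1; have -> : e * 2 + e * 3 / kap = e * (2 + 3 / kap) by ring.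
  by rewrite /e invfM -mulrA mulVf ?gt_eqF //; lra.
have [delta delta0 hdelta] := low_degree_power_sum k1 hp eps0.
(* [C] bounds |W|^(k-1) by [degree_tail] at [delta * n], so [M] bounds |W|. The integer [m] exceeds
   [p], for Bernoulli's inequality, and n >= [X] makes both error terms at most eps n. *)
pose C : R := (96 * (2 ^ k * (2 * k))%:R) ^+ k / delta ^+ k.
pose M := (Num.truncn C).+1.
pose m := (Num.truncn p).+1.
pose X : R := (M * (2 ^ M * k) + m * k)%:R / eps.
exists (Num.truncn X).+2 => G Gfree; set n := #|{: G}| => n_large Ge.
have nX : X <= n%:R.
  apply: ltW; apply: lt_le_trans (truncnS_gt X) _; rewrite ler_nat.
  exact: ltnW.
have n1 : (1 < n)%N by apply: leq_trans n_large.
have n0 : 0 < n%:R :> R by rewrite ltr0n ltnW.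
pose W := [set v : G | delta * n%:R < (deg v)%:R]%SET.
have cW : (#|W| <= M)%N.
  have := @degree_tail R G (@edge G) k (@edge_sym G) (@edge_irrefl G) k1 (free_no_cycle Gfree) W (delta * n%:R).
  have dn0 : 0 < delta * n%:R by rewrite mulr_gt0.
  move=> /(_ (ltW dn0)) H.
  have {H} : #|W|%:R ^+ k.-1 * (delta * n%:R) ^+ k <= (96 * (2 ^ k * (2 * k))%:R) ^+ k * n%:R ^+ k.
    by apply: H => v; rewrite inE degE => /ltW.
  rewrite exprMn mulrA ler_pM2r ?exprn_gt0 // -ler_pdivlMr ?exprn_gt0 // -/C => H.
  rewrite ltnW // ltnS; apply: leq_trans (_ : #|W| ^ k.-1 <= _)%N.
    have [->//|W0] := posnP #|W|.
    have k'0 : (0 < k.-1)%N by rewrite -subn1 subn_gt0.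
    by rewrite -(prednK k'0) expnS leq_pmulr // expn_gt0 W0.
  by rewrite truncn_ge_nat ?(le_trans _ H) ?exprn_ge0 ?ler0n // natrX.
pose y (v : G) : R := (deg v)%:R / n%:R.
have y01 v : 0 <= y v <= 1.
  by rewrite divr_ge0 ?ler0n //= ler_pdivrMr // mul1r ler_nat deg_le.
have yp v : (deg v)%:R `^ p = n%:R `^ p * y v `^ p.
  by rewrite -powRM ?ler0n ?divr_ge0 // mulrC divfK // gt_eqF.
have np0 : 0 < n%:R `^ p :> R by rewrite powR_gt0.
have sumW : \sum_(w in W) y w <= k.-1%:R + eps.
  rewrite /y -mulr_suml ler_pdivrMr // -natr_sum.
  have H := sum_deg_le W k1 Gfree.
  have H2 : (\sum_(w in W) deg w <= k.-1 * n + M * (2 ^ M * k))%N.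
    apply: leq_trans H _; rewrite leq_add2l leq_mul // leq_mul2r leq_exp2l //.
    by rewrite cW orbT.
  move: H2; rewrite -(ler_nat R) => /le_trans; apply.
  rewrite natrD natrM mulrDl lerD2l.
  have : (M * (2 ^ M * k))%:R <= X * eps.
    by rewrite /X divfK ?gt_eqF // ler_nat leq_addr.
  by move=> /le_trans; apply; rewrite mulrC ler_pM2l.
have sumWp : k.-1%:R - eps * 2 <= \sum_(w in W) y w `^ p.
  have E : e_p p G = \sum_(w in W) n%:R `^ p * y w `^ p +
     \sum_(v : G | (deg v)%:R <= delta * n%:R) (deg v)%:R `^ p.
    rewrite /e_p (bigID (fun v : G => v \in W)) /=; congr (_ + _).
      by apply: eq_bigr => v _; rewrite yp.
    by apply: eq_bigl => v; rewrite inE -leNgt.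
  have low := hdelta G Gfree; rewrite -/n in low.
  have pm : p <= m%:R by apply: ltW; exact: truncnS_gt.
  have nm : (1 - n%:R^-1) * n%:R = n.-1%:R :> R.
    by rewrite mulrBl mul1r mulVf ?gt_eqF // -subn1 natrB // ltnW.
  have ninv : 0 <= (n%:R^-1 : R) <= 1.
    by rewrite invr_ge0 ler0n /= invf_le1 // ler1n ltnW.
  have B : 1 - m%:R / n%:R <= (1 - n%:R^-1) `^ p :> R.
    apply: le_trans (bernoulli_ge m ninv) _.
    rewrite -powR_mulrn; last by case/andP: ninv; rewrite subr_ge0.
    apply: ger_powR => //.
    rewrite subr_gt0 invf_lt1 // ltr1n n1 /= lerBlDr lerDl.
    by case/andP: ninv.
  have B2 : k.-1%:R * (m%:R / n%:R) <= eps.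
    rewrite mulrA ler_pdivrMr //.
    have : (k.-1 * m)%:R <= X * eps.
      rewrite /X divfK ?gt_eqF // ler_nat; apply: leq_trans (leq_addl _ _).
      by rewrite mulnC leq_mul2l leq_pred orbT.
    rewrite natrM => /le_trans; apply; by rewrite mulrC ler_pM2l.
  have Ge' : k.-1%:R * (1 - n%:R^-1) `^ p * n%:R `^ p <= e_p p G.
    have h0 : 0 <= 1 - (n%:R^-1 : R) by case/andP: ninv => _; rewrite subr_ge0.
    by apply: le_trans Ge; rewrite -nm powRM ?ler0n // mulrA.
  have H : k.-1%:R * (1 - m%:R / n%:R) * n%:R `^ p <= n%:R `^ p * (\sum_(w in W) y w `^ p + eps).
    rewrite [leRHS]mulrDr [_ * eps]mulrC; apply: le_trans (_ : e_p p G <= _).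
      by apply: le_trans Ge'; rewrite ler_pM2r // ler_wpM2l.
    by rewrite E -mulr_sumr lerD2l.
  move: H; rewrite mulrC ler_pM2l // mulrBr mulr1; lra.
pose T := [set w in W | 1 - eta <= y w]%SET.
have cT : (k.-1 <= #|T|)%N.
  have split_sum (f : G -> R) : \sum_(w in W) f w = \sum_(w in T) f w + \sum_(w in W | ~~ (1 - eta <= y w)) f w.
    rewrite (bigID (fun w => 1 - eta <= y w)) /=; congr (_ + _).
    by apply: eq_bigl => w; rewrite [RHS]inE.
  have ypE v : y v `^ p = y v * y v `^ (p - 1).
    by rewrite mulr_powRB1 //; case/andP: (y01 v).
  have yple v : y v `^ p <= y v.
    case/andP: (y01 v) => h0 h1; rewrite ypE ler_piMr //.
    have E1 : 1 `^ (p - 1) = 1 :> R by rewrite powR1.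
    by rewrite -[leRHS]E1 ge0_ler_powR ?nnegrE //; lra.
  have low : kap * \sum_(w in W | ~~ (1 - eta <= y w)) y w <= \sum_(w in W) y w - \sum_(w in W) y w `^ p.
    rewrite -sumrB split_sum -[leLHS]add0r lerD //.
      by apply: sumr_ge0 => w _; rewrite subr_ge0.
    rewrite mulr_sumr; apply: ler_sum => w /andP[_]; rewrite -ltNge => yw.
    case/andP: (y01 w) => h0 h1.
    rewrite ypE /kap mulrBl mul1r lerD2l lerN2 [leRHS]mulrC ler_wpM2l //.
    by rewrite ge0_ler_powR ?nnegrE //; lra.
  have low2 : \sum_(w in W | ~~ (1 - eta <= y w)) y w <= eps * 3 / kap.
    by rewrite ler_pdivlMr // mulrC; lra.
  have lowp : \sum_(w in W | ~~ (1 - eta <= y w)) y w `^ p <= \sum_(w in W | ~~ (1 - eta <= y w)) y w.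
    exact: ler_sum.
  have topT : \sum_(w in T) y w `^ p <= #|T|%:R.
    rewrite -sumr_const; apply: ler_sum => w _; apply: le_trans (yple w) _.
    by case/andP: (y01 w).
  have : k.-1%:R < (#|T|.+1)%:R :> R.
    by move: sumWp; rewrite split_sum -natr1; lra.
  by rewrite ltr_nat ltnS.
have [S ST cS] := exists_subset_card cT.
exists S => // s /(fintype.subsetP ST); rewrite inE => /andP[_].
by rewrite /y ler_pdivlMr.
Qed.

End Heavy.

(** * Comparison with the extremal graph *)

Section Induced.
Variables (G : sgraph) (A : {set G}).

Definition induced_rel : rel {x : G | x \in A} := fun x y => edge (val x) (val y).

Lemma induced_sym : symmetric induced_rel.
Proof. by move=> x y; exact: edge_sym. Qed.

Lemma induced_irrefl : irreflexive induced_rel.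
Proof. by move=> x; exact: edge_irrefl. Qed.

Definition induced : sgraph := SGraph induced_sym induced_irrefl.

Lemma card_induced : #|{: induced}| = #|A|.
Proof. exact: card_sig. Qed.

Lemma free_induced (F : sgraph) : free F G -> free F induced.
Proof.
move=> FG [f f_inj f_hom]; apply: FG; exists (fun x => val (f x)) => //.
exact: inj_comp val_inj f_inj.
Qed.

Lemma deg_induced (x : induced) : deg x = #|nbrs_in (@edge G) A (val x)|.
Proof.
rewrite /deg -(card_imset _ val_inj); apply: eq_card => y; apply/imsetP/idP.
  by move=> [z]; rewrite !inE => xz ->; rewrite (valP z).
rewrite !inE => /andP[yA xy].
by exists (exist _ y yA); rewrite ?inE.
Qed.

Lemma e_p_induced (R : realType) (p : R) :
  e_p p induced = \sum_(x in A) #|nbrs_in (@edge G) A x|%:R `^ p.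
Proof.
rewrite [RHS](reindex_omap (fun x : {x : G | x \in A} => val x) insub) /=; last first.
  by move=> x xA; rewrite insubT.
rewrite /e_p; apply: eq_big => [x|x _]; last by rewrite deg_induced.
by rewrite valK eqxx (valP x).
Qed.

End Induced.

Lemma card_nbrs_in_split (G : sgraph) (A B : {set G}) (v : G) :
  (#|nbrs_in (@edge G) (A :|: B)%SET v| <= #|nbrs_in (@edge G) A v| + #|nbrs_in (@edge G) B v|)%N.
Proof.
apply: leq_trans (leq_card_setU _ _); apply: subset_leq_card.
by apply/fintype.subsetP => x; rewrite !finset.inE andb_orl.
Qed.

Lemma card_nbrs_in_le (G : sgraph) (A : {set G}) (v : G) : (#|nbrs_in (@edge G) A v| <= #|A|)%N.
Proof. by apply: subset_leq_card; apply/fintype.subsetP => x; rewrite inE => /andP[]. Qed.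

(** * Degree powers on S, its common neighbours Q and the remaining vertices B *)

Section Structure.
Variables (R : realType) (p : R) (k : nat) (G : sgraph) (S : {set G}).
Hypothesis p_gt1 : 1 < p.
Let p_gt0 : 0 < p := lt_trans ltr01 p_gt1.
Let p_ge0 : 0 <= p := ltW p_gt0.
Let p1_ge0 : 0 <= p - 1.
Proof. by rewrite subr_ge0 ltW. Qed.
Hypothesis k_gt1 : (1 < k)%N.
Hypothesis Gfree : free (cycle_graph (2 * k)) G.
Hypothesis cS : #|S| = k.-1.
Let Q := common_nbrs S.
Hypothesis Q_large : (k.+1 < #|Q|)%N.
Let B : {set G} := (~: (S :|: Q))%SET.
Let n := #|{: G}|.
Let dB (v : G) := #|nbrs_in (@edge G) B v|.

Lemma disjoint_common_nbrs : [disjoint S & Q].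
Proof.
by apply/pred0P => x /=; apply/negbTE/negP => /andP[xS /common_nbrs_notin]; rewrite xS.
Qed.

Lemma card_parts : (k.-1 + #|Q| + #|B| = n)%N.
Proof.
rewrite /n -cS -(cardsC (S :|: Q)%SET) cardsU.
by rewrite disjoint_setI0 ?cards0 ?subn0 // disjoint_common_nbrs.
Qed.

Lemma sum_parts (f : G -> R) :
  \sum_v f v = \sum_(v in S) f v + \sum_(v in Q) f v + \sum_(v in B) f v.
Proof.
rewrite (bigID (fun v => v \in (S :|: Q)%SET)) /=; congr (_ + _).
  rewrite -bigU ?disjoint_common_nbrs //=.
  by apply: eq_bigl => v; rewrite !finset.inE.
by apply: eq_bigl => v; rewrite !finset.inE.
Qed.

Lemma deg_parts v :
  (deg v <= #|nbrs_in (@edge G) S v| + #|nbrs_in (@edge G) Q v| + dB v)%N.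
Proof.
rewrite degE; have -> : [set: G]%SET = ((S :|: Q) :|: B)%SET by rewrite finset.setUCr.
apply: leq_trans (card_nbrs_in_split _ _ _) _; rewrite leq_add2r.
exact: card_nbrs_in_split.
Qed.

Lemma nbrs_Q v : v \notin S -> (#|nbrs_in (@edge G) Q v| <= 1)%N.
Proof. by move=> vS; apply: (nbrs_common_nbrs Gfree) => //; exact: ltnW. Qed.

Lemma B_notinS v : v \in B -> v \notin S.
Proof. by rewrite !finset.inE negb_or => /andP[]. Qed.

(** Each vertex of [B] misses at least one vertex of [S], so at least [#|B|] of the possible
    adjacencies of [S] are absent. *)
Lemma sum_deg_S : (#|B| + \sum_(s in S) deg s <= k.-1 * n.-1)%N.
Proof.
pose Bs (s : G) := [set r in B | ~~ edge s r]%SET.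
have cB : (#|B| <= \sum_(s in S) #|Bs s|)%N.
  have -> : (\sum_(s in S) #|Bs s| = \sum_(s in S) \sum_(r in B) ~~ edge s r)%N.
    apply: eq_bigr => s _; rewrite -sum1_card.
    rewrite (eq_bigl (fun r => (r \in B) && ~~ edge s r)); last by move=> r; rewrite [LHS]inE.
    by rewrite big_mkcondr; apply: eq_bigr => r _; case: (edge s r).
  rewrite exchange_big -sum1_card; apply: leq_sum => r.
  rewrite !finset.inE negb_or => /andP[_]; rewrite negb_forall => /existsP[s].
  by rewrite negb_imply => /andP[sS sr]; rewrite (bigD1 s) //= sr.
have cs s : s \in S -> (#|Bs s| + deg s <= n.-1)%N.
  move=> sS; rewrite /n -(cardsC1 s) /deg -cardsUI.
  have -> : (Bs s :&: [set w | edge s w])%SET = finset.set0.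
    by apply/setP => r; rewrite !finset.inE; case: (edge s r); rewrite ?andbF.
  rewrite cards0 addn0; apply: subset_leq_card; apply/fintype.subsetP => r.
  rewrite finset.in_setC finset.in_set1 finset.in_setU => /orP[|].
    rewrite inE => /andP[/B_notinS rS _].
    by apply: contraNneq rS => ->.
  by rewrite inE => sr; apply: contraTneq sr => ->; rewrite edge_irrefl.
apply: leq_trans (leq_add cB (leqnn _)) _; rewrite -big_split -cS -sum_nat_const /=.
exact: leq_sum.
Qed.

Lemma powR_split (x : R) : 0 <= x -> x `^ p = x * x `^ (p - 1).
Proof. by move=> x0; rewrite mulr_powRB1 //; exact: p_gt0. Qed.

Lemma ler_powR_nat (r : R) (a b : nat) : 0 <= r -> (a <= b)%N -> a%:R `^ r <= b%:R `^ r :> R.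
Proof. by move=> r0 ab; rewrite ge0_ler_powR ?nnegrE ?ler0n ?ler_nat. Qed.

(** Bounding d^p by d (n - 1)^(p-1) makes the sum linear in the degrees, so each missing adjacency
    costs (n - 1)^(p-1). *)
Lemma e_p_S : \sum_(s in S) (deg s)%:R `^ p <=
  k.-1%:R * n.-1%:R `^ p - #|B|%:R * n.-1%:R `^ (p - 1).
Proof.
have H (s : G) : s \in S -> (deg s)%:R `^ p <= (deg s)%:R * n.-1%:R `^ (p - 1).
  move=> sS; rewrite powR_split ?ler0n // ler_wpM2l // ler_powR_nat //.
  have sub : ([set w | edge s w] \subset [set~ s])%SET.
    by apply/fintype.subsetP => w; rewrite !inE; apply: contraTneq => ->; rewrite edge_irrefl.
  by apply: leq_trans (subset_leq_card sub) _; rewrite cardsC1.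
apply: le_trans (ler_sum _ H) _.
rewrite -mulr_suml -natr_sum [n.-1%:R `^ p]powR_split ?ler0n // mulrA -mulrBl.
rewrite ler_wpM2r ?powR_ge0 // lerBrDl -natrD -natrM ler_nat.
exact: sum_deg_S.
Qed.

Lemma sum_dB_Q : (\sum_(q in Q) dB q <= #|B|)%N.
Proof.
rewrite sum_nbrs_in_sym; last exact: edge_sym.
by rewrite -sum1_card; apply: leq_sum => r /B_notinS; exact: nbrs_Q.
Qed.

Lemma powR_addn_le (a b : nat) : (a + b)%:R `^ p <= 2 `^ p * (a%:R `^ p + b%:R `^ p) :> R.
Proof.
wlog ab : a b / (a <= b)%N.
  move=> H; have [/H//|/ltnW/H] := leqP a b.
  by rewrite addnC [b%:R `^ p + _]addrC.
apply: le_trans (_ : (2 * b)%:R `^ p <= _).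
  by rewrite ler_powR_nat // mul2n -addnn leq_add2r.
rewrite natrM powRM ?ler0n // ler_wpM2l ?powR_ge0 //.
by rewrite lerDr powR_ge0.
Qed.

(** A vertex of [B] has at most k - 1 neighbours in [S] and one in [Q]; the rest of its degree is
    its degree in the graph induced on [B]. *)
Lemma e_p_B (C : R) : e_p p (induced B) <= C * #|B|%:R `^ p ->
  \sum_(r in B) (deg r)%:R `^ p <=
    2 `^ p * (k%:R `^ p * #|B|%:R + C * #|B|%:R `^ p).
Proof.
rewrite e_p_induced => HC.
have H (r : G) : r \in B -> (deg r)%:R `^ p <= 2 `^ p * (k%:R `^ p + (dB r)%:R `^ p).
  move=> rB; apply: le_trans (powR_addn_le _ _); rewrite ler_powR_nat //.
  apply: leq_trans (deg_parts r) _; rewrite leq_add2r -(ltn_predK k_gt1) -addn1.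
  by rewrite leq_add ?nbrs_Q ?B_notinS // -cS card_nbrs_in_le.
apply: le_trans (ler_sum _ H) _.
rewrite -mulr_sumr ler_wpM2l ?powR_ge0 // big_split /= sumr_const mulr_natr lerD2l.
exact: HC.
Qed.

(** A vertex of [Q] without neighbours in [B] has degree at most [b], or at most [k] if it is in
    [P]. One with d > 0 neighbours in [B] has degree at most k + d <= (k + 1) d; then d^p <= d
    |B|^(p-1), and the d sum to at most |B|. *)
Lemma e_p_Q (P : {set G}) (b : nat) : (#|P| <= 2)%N ->
  {in Q, forall q, q \notin P -> k.-1 + #|nbrs_in (@edge G) Q q| <= b}%N ->
  \sum_(q in Q) (deg q)%:R `^ p <=
    #|Q|%:R * b%:R `^ p + 2 * k%:R `^ p + k.+1%:R `^ p * #|B|%:R `^ p.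
Proof.
move=> cP hP.
have H (q : G) : q \in Q -> (deg q)%:R `^ p <=
    b%:R `^ p + (q \in P)%:R * k%:R `^ p + k.+1%:R `^ p * ((dB q)%:R * #|B|%:R `^ (p - 1)).
  move=> qQ; have qS := common_nbrs_notin qQ.
  have h0 : 0 <= b%:R `^ p :> R by exact: powR_ge0.
  have h1 : 0 <= (q \in P)%:R * k%:R `^ p :> R by rewrite mulr_ge0 ?powR_ge0.
  have h2 : 0 <= k.+1%:R `^ p * ((dB q)%:R * #|B|%:R `^ (p - 1)) :> R by rewrite !mulr_ge0 ?powR_ge0.
  have dq : (deg q <= k.-1 + #|nbrs_in (@edge G) Q q| + dB q)%N.
    by apply: leq_trans (deg_parts q) _; rewrite !leq_add2r -cS card_nbrs_in_le.
  have dk : (deg q <= k + dB q)%N.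
    apply: leq_trans dq _; rewrite leq_add2r; apply: (@leq_trans (k.-1 + 1)).
      by rewrite leq_add2l nbrs_Q.
    by rewrite addn1 (ltn_predK k_gt1).
  have [d0|d0] := posnP (dB q).
    rewrite d0 mul0r mulr0 addr0.
    have [qP|qP] := boolP (q \in P).
      rewrite mul1r -[leLHS]add0r lerD // ler_powR_nat //.
      by rewrite d0 addn0 in dk.
    rewrite mul0r addr0 ler_powR_nat //; apply: leq_trans dq _.
    by rewrite d0 addn0 hP.
  rewrite -[leLHS]add0r lerD ?addr_ge0 //.
  apply: le_trans (_ : (k.+1 * dB q)%:R `^ p <= _).
    rewrite ler_powR_nat //; apply: leq_trans dk _.
    by rewrite mulSn addnC leq_add2l leq_pmulr.
  rewrite natrM powRM ?ler0n // ler_wpM2l ?powR_ge0 //.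
  rewrite powR_split ?ler0n // ler_wpM2l // ler_powR_nat ?card_nbrs_in_le //.
apply: le_trans (ler_sum _ H) _.
rewrite !big_split /= sumr_const mulr_natl -!addrA lerD2l; apply: lerD.
  rewrite -mulr_suml ler_wpM2r ?powR_ge0 // -natr_sum ler_nat; apply: leq_trans cP.
  rewrite -sum1_card [X in (_ <= X)%N]big_mkcond [X in (X <= _)%N]big_mkcond.
  by apply: leq_sum => q _; case: (q \in Q); case: (q \in P).
rewrite -mulr_sumr ler_wpM2l ?powR_ge0 // -mulr_suml.
rewrite [leRHS]powR_split ?ler0n // ler_wpM2r ?powR_ge0 // -natr_sum ler_nat.
exact: sum_dB_Q.
Qed.

(* [maxn 2 k.-1] is the typical degree outside the clique of the extremal graph: 2 when k = 2, k - 1 when k >= 3. *)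
Lemma Q_exceptions : exists2 P : {set G}, (#|P| <= 2)%N &
  {in Q, forall q, q \notin P -> k.-1 + #|nbrs_in (@edge G) Q q| <= maxn 2 k.-1}%N.
Proof.
have [k2|k2] := leqP k 2.
  exists finset.set0; first by rewrite cards0.
  move=> q /common_nbrs_notin/nbrs_Q qQ _.
  have -> : k = 2 by apply/eqP; rewrite eqn_leq k2.
  by rewrite /= ltnS.
have [P [cP _] hP] := common_nbrs_edges Gfree k2 cS Q_large.
exists P => // q qQ qP; have -> : nbrs_in (@edge G) Q q = finset.set0.
  apply/setP => x; rewrite [LHS]inE [RHS]inE; apply/negP => /andP[xQ qx].
  by case: (hP q x qQ xQ qx) => qP' _; rewrite qP' in qP.
by rewrite cards0 addn0 leq_maxr.
Qed.

End Structure.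

(** The heavy vertices form [S]. If [B] were nonempty, its cost |B| (n - 1)^(p-1) to [S] would be at
    most the gain K1 |B| + K2 |B|^p elsewhere, which fails for large n since |B| is a small fraction
    of n. *)
Lemma common_nbrs_compl (R : realType) k (p : R) : (1 < k)%N -> k%:R / (k%:R - 1) < p ->
  exists n0 : nat, forall G : sgraph, free (cycle_graph (2 * k)) G -> (n0 <= #|{: G}|)%N ->
    k.-1%:R * #|{: G}|.-1%:R `^ p + (#|{: G}| - k.-1).-1%:R * (maxn 2 k.-1)%:R `^ p <= e_p p G ->
    exists S : {set G}, [/\ #|S| = k.-1, common_nbrs S = (~: S)%SET & (k.+1 < #|common_nbrs S|)%N].
Proof.
move=> k1 hp; have p1 := exponent_gt1 k1 hp.
have [C C0 hC] := e_p_le k1 hp.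
pose b := maxn 2 k.-1.
pose K1 : R := b%:R `^ p + 2 * k%:R `^ p + 2 `^ p * k%:R `^ p.
pose K2 : R := k.+1%:R `^ p + 2 `^ p * C.
have K1_gt0 : 0 < K1.
  rewrite !addr_gt0 ?mulr_gt0 ?powR_gt0 ?ltr0n //; try exact: ltnW.
  by rewrite leq_max.
have K2_gt0 : 0 < K2 by rewrite addr_gt0 ?mulr_gt0 ?powR_gt0.
(* With |B| <= theta (n - 1), this makes K2 |B|^(p-1) at most half of (n - 1)^(p-1); the other half
   beats [K1] because n - 1 > [X] below. *)
have [theta /andP[th0 th1] hth] : exists2 theta : R, 0 < theta <= 1 & K2 * theta `^ (p - 1) <= 1 / 2.
  exists (Num.min 1 ((1 / (2 * K2)) `^ (p - 1)^-1)).
    by rewrite ge_min lexx lt_min ltr01 powR_gt0 // divr_gt0 // mulr_gt0.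
  have y0 : 0 < 1 / (2 * K2) by rewrite divr_gt0 // mulr_gt0.
  apply: le_trans (_ : K2 * ((1 / (2 * K2)) `^ (p - 1)^-1) `^ (p - 1) <= _).
    rewrite ler_pM2l // ge0_ler_powR ?nnegrE ?powR_ge0 //; first lra.
      by rewrite le_min ler01 powR_ge0.
    by rewrite ge_min lexx orbT.
  rewrite -powRrM mulVf; last by apply: lt0r_neq0; lra.
  rewrite powRr1; last exact: ltW.
  by rewrite le_eqVlt; apply/orP; left; apply/eqP; field; exact: lt0r_neq0.
have k0 : 0 < k%:R :> R by rewrite ltr0n ltnW.
(* Fewer than [k] vertices of [S] each miss at most eta n vertices, so |B| <= k eta n = theta n /
   2. *)
pose eta := theta / (2 * k%:R).
have eta0 : 0 < eta by rewrite divr_gt0 // mulr_gt0.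
have eta1 : eta < 1.
  rewrite ltr_pdivrMr ?mulr_gt0 // mul1r; apply: le_lt_trans th1 _.
  by rewrite -natrM ltr1n; move: k1; clear; lia.
have [n0 hn0] := @heavy_vertices R k p eta k1 hp (introT andP (conj eta0 eta1)).
pose X := (2 * K1) `^ (p - 1)^-1.
exists (n0 + (Num.truncn X).+2 + 4 * k.+2)%N => G Gfree.
set n := #|{: G}| => n_large Ge.
have n_ge0 : (n0 <= n)%N by apply: leq_trans n_large; rewrite -addnA leq_addr.
have nX : X < n.-1%:R.
  apply: lt_le_trans (truncnS_gt X) _; rewrite ler_nat.
  by move: n_large; move: (Num.truncn X) => t; clear; lia.
have nk : (4 * k.+2 <= n)%N by apply: leq_trans n_large; rewrite leq_addl.
have [|S cS degS] := hn0 G Gfree n_ge0.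
  by apply: le_trans Ge; rewrite lerDl mulr_ge0 ?powR_ge0.
exists S.
set B := (~: (S :|: common_nbrs S))%SET.
have parts := card_parts cS; rewrite -/B -/n in parts.
have sumS := sum_deg_S cS; rewrite -/B -/n in sumS.
have n_pos : (0 < n)%N by move: nk; clear; lia.
have Bn : #|B|%:R * 2 <= theta * n%:R.
  have H1 : k.-1%:R * ((1 - eta) * n%:R) <= (\sum_(s in S) deg s)%:R.
    by rewrite -cS mulr_natl -sumr_const natr_sum; apply: ler_sum.
  have H2 : (#|B| + \sum_(s in S) deg s <= k.-1 * n)%N.
    by apply: leq_trans sumS _; rewrite leq_mul2l leq_pred orbT.
  move: H2; rewrite -(ler_nat R) natrD natrM => H2.
  have H3 : #|B|%:R <= k.-1%:R * (eta * n%:R).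
    by move: H1; rewrite mulrBl mulrBr mul1r; lra.
  have H4 : k.-1%:R * (eta * n%:R) <= k%:R * (eta * n%:R).
    by apply: ler_wpM2r; [rewrite mulr_ge0 // ltW | rewrite ler_nat leq_pred].
  have H5 : k%:R * (eta * n%:R) * 2 = theta * n%:R by rewrite /eta; field; exact: lt0r_neq0.
  by rewrite -H5 ler_pM2r //; exact: le_trans H4.
have Q_large : (k.+1 < #|common_nbrs S|)%N.
  have : (#|B| * 2 <= n)%N.
    rewrite -(ler_nat R) natrM; apply: le_trans Bn _.
    by rewrite ler_piMl.
  by move: parts nk; move: #|B| #|common_nbrs S|; clear; lia.
have [P cP hP] := Q_exceptions k1 Gfree cS Q_large.
have SQ : B = finset.set0 -> common_nbrs S = (~: S)%SET.
  move=> B0; apply/setP => x; rewrite [RHS]inE; apply/idP/idP; first exact: common_nbrs_notin.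
  move=> xS; have : x \notin B by rewrite B0 inE.
  by rewrite [_ \in B]inE negbK [_ \in _ :|: _]inE (negbTE xS).
have [B0|B0] := eqVneq B finset.set0; last first.
  exfalso.
  have B_gt0 : (0 < #|B|)%N by rewrite card_gt0.
  have eS := e_p_S p1 cS; rewrite -/B -/n in eS.
  have eQ := e_p_Q p1 k1 Gfree cS Q_large cP hP; rewrite -/B -/b in eQ.
  have eB := @e_p_B R p k G S p1 k1 Gfree cS Q_large C.
  have := hC _ (free_induced Gfree (A := B)).
  rewrite card_induced => /eB {}eB; rewrite -/B in eB.
  move: Ge; rewrite /e_p (sum_parts S) -/B -/b => Ge.
  (* The assumed lower bound counts one vertex fewer than lies outside [S]; the resulting extra b^p
     is absorbed into [K1 * #|B|], as |B| >= 1. *)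
  have nQB : #|common_nbrs S|%:R + #|B|%:R <= (n - k.-1).-1%:R + 1 :> R.
    rewrite natr1 -natrD ler_nat; move: parts B_gt0; move: #|B| #|common_nbrs S| (n : nat) => x1 x2 x3; clear; lia.
  have b0 : 0 <= b%:R `^ p :> R by rewrite powR_ge0.
  have := ler_wpM2r b0 nQB; rewrite mulrDl [in X in _ <= X]mulrDl mul1r => nQB'.
  have Bb : 0 <= #|B|%:R * b%:R `^ p :> R by rewrite mulr_ge0.
  have B1 : 1 <= #|B|%:R :> R by rewrite ler1n.
  have BK : b%:R `^ p + 2 * k%:R `^ p + 2 `^ p * (k%:R `^ p * #|B|%:R) <= K1 * #|B|%:R.
    rewrite /K1 [leRHS]mulrDl -[2 `^ p * _ * _]mulrA lerD2r ler_peMr // addr_ge0 //.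
  have main : #|B|%:R * n.-1%:R `^ (p - 1) <= K1 * #|B|%:R + K2 * #|B|%:R `^ p.
    rewrite /K2 [(_ + _ * C) * _]mulrDl -[2 `^ p * C * _]mulrA.
    move: eS eQ eB Ge nQB' Bb BK; rewrite mulrDr.
    move: (\sum_(v in S) _) (\sum_(v in common_nbrs S) _) (\sum_(v in B) _) => x1 x2 x3.
    set a1 := k.-1%:R * _; set a2 := #|B|%:R * n.-1%:R `^ _; set a3 := #|common_nbrs S|%:R * _.
    set a4 := _ `^ p * #|B|%:R `^ p; set a5 := 2 `^ p * (k%:R `^ p * _); set a6 := 2 `^ p * (C * _).
    set a7 := (n - k.-1).-1%:R * _; set a8 := #|B|%:R * b%:R `^ p; set a9 := K1 * _.
    clear; lra.
  have {main} : n.-1%:R `^ (p - 1) <= K1 + K2 * #|B|%:R `^ (p - 1).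
    move: main; rewrite [#|B|%:R `^ p](powR_split p1) ?ler0n // [K2 * _]mulrCA [K1 * _]mulrC -mulrDr ler_pM2l //.
    by rewrite ltr0n.
  have : K2 * #|B|%:R `^ (p - 1) <= 1 / 2 * n.-1%:R `^ (p - 1).
    apply: le_trans (_ : K2 * (theta * n.-1%:R) `^ (p - 1) <= _).
      rewrite ler_pM2l // ge0_ler_powR ?nnegrE ?ler0n ?mulr_ge0 ?(ltW th0) //; first lra.
      have : n%:R <= n.-1%:R * 2 :> R.
        by rewrite -natrM ler_nat; move: nk; clear; lia.
      move=> /(ler_wpM2l (ltW th0)); lra.
    rewrite powRM ?ler0n ?(ltW th0) // mulrA ler_wpM2r ?powR_ge0 //.
  have : 2 * K1 < n.-1%:R `^ (p - 1).
    have -> : 2 * K1 = X `^ (p - 1).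
      rewrite /X -powRrM mulVf; last by apply: lt0r_neq0; lra.
      by rewrite powRr1 // mulr_ge0 // ltW.
    by rewrite gt0_ltr_powR ?nnegrE ?powR_ge0 //; lra.
  lra.
by split=> //; exact: SQ B0.
Qed.

(** * From isomorphism to unique extremality *)

Lemma isomorphic_e_p (R : realType) (p : R) (G H : sgraph) : isomorphic G H -> e_p p G = e_p p H.
Proof.
move=> [f f_bij f_edge]; rewrite /e_p [RHS](reindex f) /=; last by apply: onW_bij.
apply: eq_bigr => v _; congr (_%:R `^ _).
rewrite /deg -(card_imset _ (bij_inj f_bij)); have [g fK gK] := f_bij.
apply: eq_card => w; apply/imsetP/idP.
  by move=> [x]; rewrite !inE => vx ->; rewrite f_edge.
by rewrite inE => vw; exists (g w); rewrite ?gK // inE -f_edge gK.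
Qed.

(** A graph with a larger value would be isomorphic to [E] and so have the same value. Hence
    [e_p p E] bounds the set, and the supremum is attained. *)
Lemma unique_extremalP (R : realType) (p : R) n (F E : sgraph) :
  #|{: E}| = n -> free F E ->
  (forall G : sgraph, #|{: G}| = n -> free F G -> e_p p E <= e_p p G -> isomorphic G E) ->
  ex_p p n F = e_p p E /\ unique_extremal p n F E.
Proof.
move=> cE Efree H.
have exE : ex_p p n F = e_p p E.
  apply/eqP; rewrite eq_le; apply/andP; split.
    apply: ge_sup; first by exists (e_p p E); exists E.
    move=> x [G [cG Gfree ->]]; rewrite leNgt; apply/negP => lt.
    by have := lt; rewrite (isomorphic_e_p p (H G cG Gfree (ltW lt))) ltxx.
  apply: ub_le_sup; last by exists E.
  exists (e_p p E) => x [G [cG Gfree ->]]; rewrite leNgt; apply/negP => lt.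
  by have := lt; rewrite (isomorphic_e_p p (H G cG Gfree (ltW lt))) ltxx.
split=> //; split; first by split.
by move=> G [cG Gfree eG]; apply: H => //; rewrite eG exE.
Qed.

Theorem theorem1p7 (R : realType) :
  (forall p : R, 2 < p ->
     exists n0 : nat, forall n : nat, (n0 <= n)%N ->
       ex_p p n (cycle_graph 4) = e_p p (Lgraph1 n 1) /\
       unique_extremal p n (cycle_graph 4) (Lgraph1 n 1))
  /\
  (forall (k : nat) (p : R), (3 <= k)%N -> k%:R / (k%:R - 1) < p ->
     exists n0 : nat, forall n : nat, (n0 <= n)%N ->
       ex_p p n (cycle_graph (2 * k)) = e_p p (Egraph n (k - 1)) /\
       unique_extremal p n (cycle_graph (2 * k)) (Egraph n (k - 1))).
Proof.
split=> [p p2|k p k3 hp].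
  (* Part (a) is the case k = 2 of the common argument, where k / (k - 1) is 2. *)
  have hp : 2%:R / (2%:R - 1) < p :> R.
    by have -> : 2%:R / (2%:R - 1) = 2 :> R by field.
  have p0 : 0 < p by lra.
  have [n0 hn0] := common_nbrs_compl (isT : (1 < 2)%N) hp.
  exists (n0 + 1)%N => n n_large; have n1 : (1 <= n)%N by move: n_large; clear; lia.
  apply: unique_extremalP; [by rewrite card_join !card_ord subnKC | exact: Lgraph1_free |].
  move=> G cG Gfree le; rewrite -cG in le *.
  have [||S [cS SQ big]] := hn0 G Gfree; first by rewrite cG; move: n_large; clear; lia.
    apply: le_trans le; rewrite /= mul1r subn1; apply: Lgraph1_e_p_ge; first exact: ltW.
    by rewrite cG.
  by apply: (isomorphic_Lgraph1 p0 Gfree cS SQ) => //; exact: ltnW.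
have k1 : (1 < k)%N := ltnW k3.
have p0 : 0 < p by have := exponent_gt1 k1 hp; lra.
have [n0 hn0] := common_nbrs_compl k1 hp.
rewrite subn1; exists (n0 + k)%N => n n_large; have kn : (k.-1 <= n)%N by move: n_large; clear; lia.
apply: unique_extremalP; [by rewrite card_join !card_ord subnKC | exact: Egraph_free |].
move=> G cG Gfree le; rewrite -cG in le *.
have [||S [cS SQ big]] := hn0 G Gfree; first by rewrite cG; move: n_large; clear; lia.
  have -> : maxn 2 k.-1 = k.-1 by apply/maxn_idPr; move: k3; clear; lia.
  by apply: le_trans le; apply: Egraph_e_p_ge; [exact: ltW | rewrite cG].
exact: isomorphic_Egraph p0 k3 Gfree cS SQ big le.
Qed.
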